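(* Let $K$ be a totally real number field, $\mathcal O^+$ the set of totally positive algebraic integers of $K$, and $\mathcal P\subset\mathcal O^+$ the set of primitive elements. For integers $k\ge2$ and $1\le i\le k$, the following identities hold between formal power $q$-sums with exponents in $\mathcal O^+\cup\{0\}$: \begin{align*} &\prod_{\gamma\in\mathcal P}\left(\sum_{n_1,n_2,\ldots,n_{k-1}\ge0}\frac{q^{(N_1^2+N_2^2+\cdots+N_{k-1}^2+N_i+N_{i+1}+\cdots+N_{k-1})\gamma}}{(q^{\gamma})_{n_1}(q^{\gamma})_{n_2}\cdots(q^{\gamma})_{n_{k-1}}}\right)\\ =&\prod_{\gamma\in\mathcal P}\left(\prod_{\substack{n\ge1\\ n\not\equiv0,\pm i\ (\mathrm{mod}\ 2k+1)}}\frac1{1-q^{n\gamma}}\right)=\prod_{\substack{\delta\in\mathcal O^+\\ s(\delta)\not\equiv0,\pm i\ (\mathrm{mod}\ 2k+1)}}\frac1{1-q^{\delta}}, \end{align*} where $N_j=n_j+n_{j+1}+\cdots+n_{k-1}$ for $1\le j\le k-1$ (and $N_i+\cdots+N_{k-1}$ is the empty sum $0$ when $i=k$).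
   Context: An element $\gamma\in\mathcal O^+$ is primitive if $\gamma\notin n\mathcal O^+$ for every rational integer $n\ge 2$. Every $\delta\in\mathcal O^+$ can be written uniquely as $\delta=s(\delta)t(\delta)$ with $s(\delta)\in\mathbb Z^+$ (the scale) and $t(\delta)\in\mathcal P$ (the primitive factor). Formal power $q$-sums: with $H=\mathcal O^+\cup\{0\}$ (a monoid under addition), $\mathbb R[[q]]_H$ is the ring of formal expressions $\sum_{\delta\in H}c_\delta q^\delta$, $c_\delta\in\mathbb R$, with coefficientwise addition and product $(\sum c_\delta q^\delta)(\sum d_\delta q^\delta)=\sum_{\gamma}\left(\sum_{\alpha+\beta=\gamma}c_\alpha d_\beta\right)q^\gamma$; this is well defined because each $\gamma\in H$ has finitely many decompositions $\gamma=\alpha+\beta$ with $\alpha,\beta\in H$. Infinite sums are taken coefficientwise. For $\delta\in\mathcal O^+$, $\frac1{1-q^\delta}$ means $1+q^\delta+q^{2\delta}+\cdots$. For a family $f_j=\sum_\delta a_{j,\delta}q^\delta$ ($j\in J$) with all $a_{j,0}=1$ and, for each nonzero $\delta\in H$, only finitely many $j$ with $a_{j,\delta}\ne0$, the product $\prod_{j\in J}f_j$ is $\sum_\delta c_\delta q^\delta$, where $c_\delta$ is the sum of $a_{j_1,\delta_1}\cdots a_{j_r,\delta_r}$ over all finite sets of pairs $\{(j_1,\delta_1),\ldots,(j_r,\delta_r)\}$ with $j_1,\dots,j_r\in J$ pairwise distinct, $\delta_1,\ldots,\delta_r\in\mathcal O^+$ and $\delta_1+\cdots+\delta_r=\delta$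 (so $c_0=1$). For $\gamma\in\mathcal O^+$, $(q^\gamma)_n=\prod_{j=1}^n(1-q^{j\gamma})$, with $(q^\gamma)_0=1$. *)

(* Defs.v *)
From HB Require Import structures.
From mathcomp Require Import all_boot all_order all_algebra all_field.
From mathcomp Require Import finmap.
From mathcomp Require Import boolp classical_sets functions fsbigop reals.

Set Implicit Arguments.
Unset Strict Implicit.
Unset Printing Implicit Defensive.

Import Order.TTheory GRing.Theory Num.Theory.
Local Open Scope classical_set_scope.
Local Open Scope ring_scope.

(* A number field is a [fieldExtType rat].  Its complex embeddings take values
   in algebraic numbers, so they are the ring morphisms to [algC]; in [algC],
   [0 < z] means that [z] is real and positive. *)
Definition totally_real (K : fieldExtType rat) : Prop :=
  forall (f : {rmorphism K -> algC}) (x : K), f x \is Num.real.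

Definition totally_positive (K : fieldExtType rat) (x : K) : Prop :=
  forall f : {rmorphism K -> algC}, 0 < f x.

Definition algebraic_integer (K : fieldExtType rat) (x : K) : Prop :=
  integralOver (intr : int -> K) x.

Definition tp_integer (K : fieldExtType rat) (x : K) : Prop :=
  algebraic_integer x /\ totally_positive x.

Definition expo_pred (K : fieldExtType rat) : {pred K} :=
  fun x => `[< tp_integer x \/ x = 0 >].

Lemma expo_pred_addr_closed (K : fieldExtType rat) : addr_closed (@expo_pred K).
Proof.
split; first by apply/asboolP; right.
move=> x y /asboolP[[ix px]|->] /asboolP[[iy py]|->]; apply/asboolP;
  rewrite ?addr0 ?add0r; [left|left|left|right] => //.
by split; [exact: integral_add|move=> f; rewrite rmorphD addr_gt0].
Qed.

(* The additive monoid H of exponents. *)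
Record expo (K : fieldExtType rat) :=
  Expo { expo_val : K; expo_valP : expo_val \in @expo_pred K }.

HB.instance Definition _ (K : fieldExtType rat) := [isSub for @expo_val K].
HB.instance Definition _ (K : fieldExtType rat) := [Choice of expo K by <:].
HB.instance Definition _ (K : fieldExtType rat) :=
  GRing.SubChoice_isSubNmodule.Build K (fun x => x \in @expo_pred K) (expo K)
    (@expo_pred_addr_closed K).

Definition Oplus (K : fieldExtType rat) : set (expo K) :=
  [set d | tp_integer (val d)].

Definition primitive (K : fieldExtType rat) : set (expo K) :=
  [set g | Oplus g /\
    forall n : nat, (2 <= n)%N -> ~ exists2 b, Oplus b & g = b *+ n].

(* s(d), for d in [Oplus K]; the default value 0 is irrelevant there. *)
Definition scale (K : fieldExtType rat) (d : expo K) : nat :=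
  xget 0%N [set n : nat | (0 < n)%N /\ exists2 t, primitive t & d = t *+ n].

(* Formal power q-sums.  The sums [\sum_(i \in A) F i] below are finite-support
   sums: they range over the i in A with F i != 0 (and are 0 by default if there
   are infinitely many of these). *)
Definition qsums (R : realType) (K : fieldExtType rat) : Type := expo K -> R.

Section QSums.
Variables (R : realType) (K : fieldExtType rat).
Implicit Types (f g : qsums R K) (d : expo K).

Definition qmon d : qsums R K := fun x => (x == d)%:R.

Definition qone : qsums R K := qmon 0.

Definition qsub f g : qsums R K := fun x => f x - g x.

Definition qmul f g : qsums R K := fun c =>
  \sum_(p \in [set p : expo K * expo K | p.1 + p.2 = c]) f p.1 * g p.2.

(* Multiplicative inverse, for the product [qmul]. *)
Definition qinv f : qsums R K :=
  xget (fun=> 0 : R) [set g : expo K -> R | qmul f g = qone].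

(* Coefficientwise infinite sum. *)
Definition qsum (I : choiceType) (F : I -> qsums R K) : qsums R K :=
  fun x => \sum_(i \in [set: I]) F i x.

(* 1 / (1 - q^d) *)
Definition qgeom d : qsums R K := qsum (fun n : nat => qmon (d *+ n)).

(* Infinite product of the [f j], j in D: [S] is the finite set of pairs
   (j_1, d_1), ..., (j_r, d_r) with pairwise distinct first components. *)
Definition qprod (J : choiceType) (D : set J) (f : J -> qsums R K) : qsums R K :=
  fun c =>
  \sum_(S \in [set S : {fset J * expo K} |
      [/\ forall p, p \in S -> D p.1 /\ Oplus p.2,
          {in S &, injective (fun p : J * expo K => p.1)}
        & \sum_(p <- S) p.2 = c]])
    \prod_(p <- S) f p.1 p.2.

(* (q^d)_n *)
Definition qpoch d (n : nat) : qsums R K :=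
  \big[qmul/qone]_(1 <= j < n.+1) qsub qone (qmon (d *+ j)).

End QSums.

(* N_j = n_j + ... + n_m; the component n_l is stored at index l - 1. *)
Definition tailsum (m : nat) (n : {ffun 'I_m -> nat}) (j : nat) : nat :=
  (\sum_(l < m | (j <= l.+1)%N) n l)%N.

Definition AG_exponent (k i : nat) (n : {ffun 'I_k.-1 -> nat}) : nat :=
  (\sum_(1 <= j < k) tailsum n j ^ 2 + \sum_(i <= j < k) tailsum n j)%N.

Definition AG_sum (R : realType) (K : fieldExtType rat) (k i : nat)
    (g : expo K) : qsums R K :=
  qsum (fun n : {ffun 'I_k.-1 -> nat} =>
    qmul (qmon R (g *+ AG_exponent i n))
         (qinv (\big[@qmul R K/@qone R K]_(l < k.-1) qpoch R g (n l)))).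

(* n is not congruent to 0, i, -i modulo 2k+1. *)
Definition AG_residue (k i n : nat) : Prop :=
  [/\ (n%:Z != 0 %[mod (2 * k + 1)%N%:Z])%Z,
      (n%:Z != i%:Z %[mod (2 * k + 1)%N%:Z])%Z
    & (n%:Z != - i%:Z %[mod (2 * k + 1)%N%:Z])%Z].

(* Main.v *)
(** To prove the Andrews-Gordon identities modulo [q^N], work in a commutative
    ring in which [q^N = 0], where all sums and products are finite.  With the
    parameter [x = q^m], the multiple sums and the Selberg-Andrews series
    [J_{k,i}(x; q)] both satisfy
      [F_i(m) = F_{i-1}(m) + q^((m+1)(i-1)) F_{k-i+1}(m+1)],  [F_0(m) = 0],
    and both are 1 modulo [q^(m+1)] for [i > 0]; iterating the recurrence makes
    their difference divisible by every power of [q].  At [m = 0] the series is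
    evaluated by the Jacobi triple product, a limit of the q-binomial theorem.

    In [O^+] each element has finitely many decompositions: the conjugates of a
    summand are bounded, so its minimal polynomial has bounded integer
    coefficients.  Hence the q-sums form a commutative monoid under
    multiplication, each coefficient of an infinite product is a coefficient of
    a finite subproduct, and the second identity is the regrouping of the
    factors [1 / (1 - q^d)] according to the primitive factor of [d = s(d) t(d)]. *)

From HB Require Import structures.
Require Import Defs.
From mathcomp Require Import all_boot all_order all_algebra all_field.
From mathcomp Require Import qpoly finmap zify ring.
From mathcomp Require Import boolp classical_sets functions cardinality fsbigop reals.

Set Implicit Arguments.
Unset Strict Implicit.
Unset Printing Implicit Defensive.

Import Order.TTheory GRing.Theory Num.Theory.
Local Open Scope ring_scope.

(** * The Andrews-Gordon identities modulo a power of [q] *)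

Section Truncated.
Variables (A : comNzRingType) (q : A) (N : nat).
Hypothesis qN : q ^+ N = 0.

Lemma expq0 n : (N <= n)%N -> q ^+ n = 0.
Proof. by move=> le_Nn; rewrite -(subnK le_Nn) exprD qN mulr0. Qed.

(* 1 / (1 - q^n), for n > 0 *)
Definition tgeom n : A := \sum_(m < N) q ^+ (n * m).

Lemma tgeomK n : (0 < n)%N -> (1 - q ^+ n) * tgeom n = 1.
Proof.
move=> n_gt0; have -> : tgeom n = \sum_(m < N) (q ^+ n) ^+ m.
  by apply: eq_bigr => m _; rewrite exprM.
have := subrX1 (q ^+ n) N; have -> : (q ^+ n) ^+ N = 0.
  by rewrite -exprM expq0 // leq_pmull.
rewrite sub0r => def1; apply: oppr_inj; rewrite [RHS]def1; ring.
Qed.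

Lemma tgeom_large n : (0 < N)%N -> (N <= n)%N -> tgeom n = 1.
Proof.
move=> N_gt0 le_n; rewrite /tgeom (bigD1 (Ordinal N_gt0)) //= muln0 big1 ?addr0 //.
move=> m neq0; rewrite expq0 // (leq_trans le_n) // leq_pmulr // lt0n.
by apply: contra neq0 => /eqP m0; apply/eqP/val_inj.
Qed.

(* (q)_n and 1 / (q)_n *)
Definition tpoch n : A := \prod_(1 <= j < n.+1) (1 - q ^+ j).
Definition tpochV n : A := \prod_(1 <= j < n.+1) tgeom j.

Lemma tpoch0 : tpoch 0 = 1. Proof. by rewrite /tpoch big_geq. Qed.
Lemma tpochV0 : tpochV 0 = 1. Proof. by rewrite /tpochV big_geq. Qed.
Lemma tpochS n : tpoch n.+1 = tpoch n * (1 - q ^+ n.+1).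
Proof. by rewrite /tpoch big_nat_recr. Qed.

Lemma tpochVS n : (1 - q ^+ n.+1) * tpochV n.+1 = tpochV n.
Proof. by rewrite /tpochV big_nat_recr //= mulrCA tgeomK // mulr1. Qed.

Lemma tpochK n : tpoch n * tpochV n = 1.
Proof.
by rewrite -big_split /= big_nat big1 // => j /andP[j_gt0 _]; rewrite tgeomK.
Qed.

Lemma tpoch_large n : (N <= n)%N -> tpoch n = tpoch N.
Proof.
move=> /subnK <-; elim: (n - N)%N => // d IH; rewrite addSn tpochS IH.
by rewrite expq0 ?subr0 ?mulr1 //; lia.
Qed.

Lemma sum_shift (F : nat -> A) : F N = 0 ->
  \sum_(n < N) F n.+1 = \sum_(n < N) F n - F 0.
Proof.
move=> FN; have : \sum_(n < N.+1) F n = \sum_(n < N) F n.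
  by rewrite big_ord_recr /= FN addr0.
by rewrite big_ord_recl /= => <-; rewrite addrAC subrr add0r.
Qed.

(* The Andrews-Gordon sum in k - 1 variables with a parameter x = q^m,
   summed over the last variable first. *)
Fixpoint AGR (k i m : nat) : A :=
  if k is k'.+1 then
    \sum_(n < N) q ^+ (m * k * n + k * n ^ 2 + (k.+1 - i) * n) *
      tpochV n * AGR k' i (m + n.*2)
  else (0 < i)%:R.

Arguments AGR : simpl never.

Lemma AGRS k i m : AGR k.+1 i m =
  \sum_(n < N) q ^+ (m * k.+1 * n + k.+1 * n ^ 2 + (k.+2 - i) * n) *
    tpochV n * AGR k i (m + n.*2).
Proof. by []. Qed.

Lemma AGR0 k m : AGR k 0 m = 0.
Proof.
by elim: k m => // k IH m; rewrite AGRS big1 // => n _; rewrite IH mulr0.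
Qed.

(** The subtraction giving the linear coefficient of the exponent is truncated: it is 0 as soon as
    [i] exceeds the number of variables, so all these indices give the same sum. *)
Lemma AGR_max k i m : (k < i)%N -> AGR k i m = AGR k k.+1 m.
Proof.
elim: k i m => [|k IH] i m lt_ki; first by rewrite /AGR lt_ki.
rewrite !AGRS.
apply: eq_bigr => n _; rewrite (IH i) ?(IH k.+2) //; last by lia.
by have -> : (k.+2 - i = k.+2 - k.+2)%N by lia.
Qed.

(** Induction on the number of variables. Expanding the inner sums by the recurrence turns
    [F_{i+1} - F_i] into two sums: [U] carries the new inner term, [V] the factor [1 - q^n]. This
    factor cancels against [1/(q)_n]; after shifting [V] by one, the recurrence at index [k.+1 - i]
    recombines both sums. *)
Lemma AGR_rec k i m : (i <= k.+1)%N ->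
  AGR k i.+1 m = AGR k i m + q ^+ (m.+1 * i) * AGR k (k.+1 - i) m.+1.
Proof.
elim: k i m => [|k IH] i m le_ik.
  case: i le_ik => [|[|//]] _; rewrite /AGR /=; first by rewrite muln0 expr0 mul1r add0r.
  by rewrite mulr0 addr0.
(* At the extreme index [i = k.+2] the added term is [F_0 = 0] and the other two indices are both
   saturated. *)
have [lt_ki|le_ik1] := ltnP k.+1 i.
  have -> : (k.+2 - i = 0)%N by lia.
  by rewrite AGR0 mulr0 addr0 AGR_max ?(@AGR_max k.+1 i) //; lia.
pose E n := (m * k.+1 * n + k.+1 * n ^ 2 + (k.+1 - i) * n)%N.
pose U n := q ^+ E n * tpochV n * q ^+ ((m + n.*2).+1 * i) *
  AGR k (k.+1 - i) (m + n.*2).+1.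
pose V n := q ^+ E n * ((1 - q ^+ n) * tpochV n) * AGR k i (m + n.*2).
have -> : AGR k.+1 i.+1 m = AGR k.+1 i m + (\sum_(n < N) U n + \sum_(n < N) V n).
  rewrite !AGRS -!big_split /=; apply: eq_bigr => n _; rewrite /U /V.
  have -> : (k.+2 - i.+1 = k.+1 - i)%N by lia.
  have -> : (m * k.+1 * n + k.+1 * n ^ 2 + (k.+2 - i) * n = E n + n)%N.
    by rewrite /E; nia.
  by rewrite IH // -/(E n) (exprD q (E n) n); ring.
(* [V] vanishes at [N] because [q^N = 0], and at 0 because of [1 - q^0], so shifting the index costs
   nothing. *)
have VN : V N = 0 by rewrite /V expq0 ?mul0r //; rewrite /E; nia.
have V0 : V 0 = 0 by rewrite /V expr0 subrr !(mul0r, mulr0).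
have -> : \sum_(n < N) V n = \sum_(n < N) V n.+1 by rewrite sum_shift // V0 subr0.
congr (_ + _); rewrite AGRS -big_split /= mulr_sumr; apply: eq_bigr => n _.
rewrite /U /V tpochVS.
have -> : (k.+2 - (k.+2 - i) = i)%N by lia.
have -> : (k.+2 - i = (k.+1 - i).+1)%N by lia.
rewrite IH; last by lia.
have -> : (k.+1 - (k.+1 - i) = i)%N by lia.
have -> : (m.+1 + n.*2 = (m + n.*2).+1)%N by lia.
have -> : (m + n.+1.*2 = (m + n.*2).+2)%N by lia.
have eqU : (m.+1 * i + (m.+1 * k.+1 * n + k.+1 * n ^ 2 + i * n) = E n + (m + n.*2).+1 * i)%N.
  rewrite /E. nia.
have eqV : (E n.+1 = E n + (m + n.*2).+1 * i + (m + n.*2).+2 * (k.+1 - i))%N.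
  rewrite /E. nia.
rewrite eqV [RHS]mulrA [X in _ = X * _]mulrA -exprD eqU !exprD; ring.
Qed.

(* (q)_oo times the Selberg-Andrews function J_{k+1,i}(x; q) at x = q^m *)
Definition AGJ (k i m : nat) : A :=
  \sum_(n < N) (-1) ^+ n *
    q ^+ (k.+1 * m * n + k.*2.+3 * 'C(n, 2) + (k.*2.+3 - i) * n) *
    (1 - q ^+ ((m + n.*2).+1 * i)) * (tpoch (n + m) * tpochV n).

Lemma AGJ0 k m : AGJ k 0 m = 0.
Proof. by rewrite /AGJ big1 // => n _; rewrite muln0 subrr mulr0 mul0r. Qed.

(** The difference of the [n]-th terms splits as [q^E (1 - q^n) + q^(E + n + (m + 2n + 1) i) (1 -
    q^(n + m + 1))]. The first bracket shortens [1/(q)_n], the second lengthens [(q)_(n+m)];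
    shifting the first sum by one pairs them as in [AGR_rec]. *)
Lemma AGJ_rec k i m : (i <= k.+1)%N ->
  AGJ k i.+1 m = AGJ k i m + q ^+ (m.+1 * i) * AGJ k (k.+1 - i) m.+1.
Proof.
move=> le_ik.
pose E n := (k.+1 * m * n + k.*2.+3 * 'C(n, 2) + (k.*2.+2 - i) * n)%N.
pose U n := (-1) ^+ n * q ^+ (E n + n + (m + n.*2).+1 * i) *
  (tpoch (n + m).+1 * tpochV n).
pose V n := (-1) ^+ n * q ^+ E n * (tpoch (n + m) * ((1 - q ^+ n) * tpochV n)).
have -> : AGJ k i.+1 m = AGJ k i m + (\sum_(n < N) U n + \sum_(n < N) V n).
  rewrite /AGJ -!big_split /=; apply: eq_bigr => n _; rewrite /U /V.
  have -> : (k.*2.+3 - i.+1 = k.*2.+2 - i)%N by lia.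
  have -> : (k.+1 * m * n + k.*2.+3 * 'C(n, 2) + (k.*2.+3 - i) * n = E n + n)%N.
    by rewrite /E; nia.
  have -> : ((m + n.*2).+1 * i.+1 = n + (n + m).+1 + (m + n.*2).+1 * i)%N by lia.
  rewrite -/(E n) tpochS (exprD q (E n + n)) !(exprD q (E n)) (exprD q (n + _)) (exprD q n).
  ring.
have VN : V N = 0 by rewrite /V expq0 ?(mulr0, mul0r) //; rewrite /E; nia.
have V0 : V 0 = 0 by rewrite /V expr0 subrr !(mul0r, mulr0).
have -> : \sum_(n < N) V n = \sum_(n < N) V n.+1 by rewrite sum_shift // V0 subr0.
congr (_ + _); rewrite -big_split /= mulr_sumr; apply: eq_bigr => n _.
rewrite /U /V tpochVS addSn addnS.
have -> : (m.+1 + n.*2 = (m + n.*2).+1)%N by lia.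
have eqU : (m.+1 * i + (k.+1 * m.+1 * n + k.*2.+3 * 'C(n, 2) + (k.*2.+3 - (k.+1 - i)) * n) =
  E n + n + (m + n.*2).+1 * i)%N.
  rewrite /E; nia.
have eqV : (E n.+1 = E n + n + (m + n.*2).+1 * i + (m + n.*2).+2 * (k.+1 - i))%N.
  rewrite /E binS bin1; nia.
rewrite eqV (exprD q (_ + (m + n.*2).+1 * i)) exprS -eqU exprD; ring.
Qed.

Lemma trunc_gt0 : (0 < N)%N.
Proof. by case: N qN => // /eqP; rewrite expr0 oner_eq0. Qed.

Definition qdvd e x := exists u, x = q ^+ e * u.

Lemma qdvd0 e : qdvd e 0. Proof. by exists 0; rewrite mulr0. Qed.

Lemma qdvdD e x y : qdvd e x -> qdvd e y -> qdvd e (x + y).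
Proof. by move=> [u ->] [v ->]; exists (u + v); rewrite mulrDr. Qed.

Lemma qdvdN e x : qdvd e x -> qdvd e (- x).
Proof. by move=> [u ->]; exists (- u); rewrite mulrN. Qed.

Lemma qdvdM e x y : qdvd e y -> qdvd e (x * y).
Proof. by move=> [u ->]; exists (x * u); rewrite mulrCA. Qed.

Lemma qdvd_exp e n x : (e <= n)%N -> qdvd e (q ^+ n * x).
Proof. by move=> /subnKC <-; exists (q ^+ (n - e) * x); rewrite exprD mulrA. Qed.

Lemma qdvd_sum e (F : 'I_N -> A) c : (forall j, val j = 0%N -> qdvd e (F j - c)) ->
  (forall j, (0 < val j)%N -> qdvd e (F j)) -> qdvd e (\sum_j F j - c).
Proof.
move=> eF0 eF; rewrite (bigD1 (Ordinal trunc_gt0)) //= addrAC.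
apply: qdvdD; first exact: eF0.
elim/big_ind: _ => [|x y|j neq0]; [exact: qdvd0 | exact: qdvdD | apply: eF].
by rewrite lt0n; apply: contra neq0 => /eqP j0; apply/eqP/val_inj.
Qed.

Lemma leq_exponent m k n a : (0 < n)%N -> (m.+1 <= m * k.+1 * n + k.+1 * n ^ 2 + a)%N.
Proof.
move=> n_gt0; apply: leq_trans (leq_addr _ _).
by rewrite -addn1 leq_add // ?muln_gt0 ?expn_gt0 ?n_gt0 // -mulnA leq_pmulr // muln_gt0.
Qed.

Lemma AGR_init k i m : (0 < i)%N -> qdvd m.+1 (AGR k i m - 1).
Proof.
move=> i_gt0; elim: k m => [|k IH] m.
  by rewrite /AGR i_gt0 subrr; apply: qdvd0.
apply: qdvd_sum => [n /= ->|n n_gt0]; last first.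
  by rewrite -mulrA; apply: qdvd_exp; apply: leq_exponent.
rewrite -[0.*2]/0%N addn0 tpochV0 mulr1 -[(0 ^ 2)%N]/0%N !muln0 mul1r; exact: IH.
Qed.

Lemma tpoch_init m : qdvd m.+1 (tpoch N - tpoch m).
Proof.
have [le_Nm|/ltnW/subnKC <-] := leqP N m.
  by rewrite tpoch_large // subrr; apply: qdvd0.
elim: (N - m)%N => [|d IH]; first by rewrite addn0 subrr; apply: qdvd0.
rewrite addnS tpochS mulrBr mulr1 addrAC; apply: qdvdD => //.
by apply: qdvdN; rewrite mulrC; apply: qdvd_exp; lia.
Qed.

(** Modulo [q^(m+1)] only the term [n = 0] survives; it reduces to [(q)_m], which agrees with
    [(q)_N] to that order. *)
Lemma AGJ_init k i m : (0 < i <= k.+1)%N -> qdvd m.+1 (AGJ k i m - tpoch N).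
Proof.
move=> /andP[i_gt0 le_ik]; apply: qdvd_sum => [n /= ->|n n_gt0]; last first.
  rewrite -!mulrA; apply/qdvdM/qdvd_exp; rewrite -addn1 leq_add //; last first.
    by rewrite muln_gt0 n_gt0 andbT; lia.
  by apply: leq_trans (leq_addr _ _); rewrite -mulnA mulnCA leq_pmulr // muln_gt0.
rewrite !muln0 !addn0 !expr0 !mul1r tpochV0 mulr1 mulrBl mul1r.
have -> : tpoch m - q ^+ (m.+1 * i) * tpoch m - tpoch N =
  - (tpoch N - tpoch m) - q ^+ (m.+1 * i) * tpoch m by ring.
apply: qdvdD; first exact/qdvdN/tpoch_init.
by apply/qdvdN/qdvd_exp; rewrite leq_pmulr.
Qed.

(** The difference of the two sides obeys the common recurrence. The outer induction, on the
    exponent [e], treats all [m] at once; the inner one, on [i], starts from [F_0 = 0]. *)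
Lemma AGR_AGJ k i m : (i <= k.+1)%N -> AGR k i m * tpoch N = AGJ k i m.
Proof.
move=> le_i; apply/eqP; rewrite -subr_eq0; apply/eqP.
suff /(_ N) [u ->] : forall e, qdvd (m.+1 + e) (AGR k i m * tpoch N - AGJ k i m).
  by rewrite expq0 ?mul0r //; lia.
move=> e; elim: e i m le_i => [|e IH] i m le_i.
  case: i le_i => [|i] le_i; first by rewrite AGR0 AGJ0 mul0r subrr; apply: qdvd0.
  rewrite addn0; have -> : AGR k i.+1 m * tpoch N - AGJ k i.+1 m =
    tpoch N * (AGR k i.+1 m - 1) - (AGJ k i.+1 m - tpoch N) by ring.
  by apply: qdvdD; [apply/qdvdM/AGR_init | apply/qdvdN/AGJ_init => //].
elim: i le_i => [|i IHi] le_i; first by rewrite AGR0 AGJ0 mul0r subrr; apply: qdvd0.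
rewrite AGR_rec ?AGJ_rec; try lia.
have -> : (AGR k i m + q ^+ (m.+1 * i) * AGR k (k.+1 - i) m.+1) * tpoch N -
    (AGJ k i m + q ^+ (m.+1 * i) * AGJ k (k.+1 - i) m.+1) =
  (AGR k i m * tpoch N - AGJ k i m) + q ^+ (m.+1 * i) *
     (AGR k (k.+1 - i) m.+1 * tpoch N - AGJ k (k.+1 - i) m.+1) by ring.
apply: qdvdD; first by apply: IHi; lia.
(* Passing from [m] to [m.+1] supplies the extra power of [q]. *)
by apply: qdvdM; rewrite -addSnnS; apply: IH; lia.
Qed.

End Truncated.

(* With d = t - s an integer, this is a d(d+1)/2 + b d(d-1)/2. *)
Definition jexp (a b s t : nat) : nat :=
  (a * ('C((t - s).+1, 2) + 'C(s - t, 2)) + b * ('C(t - s, 2) + 'C((s - t).+1, 2)))%N.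

Lemma jexpD a b s d : jexp a b s (s + d) = ((a + b) * 'C(d, 2) + a * d)%N.
Proof.
rewrite /jexp; have -> : (s + d - s = d)%N by lia.
have -> : (s - (s + d) = 0)%N by lia.
by rewrite (binS d 1) bin1 bin0n (@bin_small 1 2) //; nia.
Qed.

(** Replacing [d] by [-d] exchanges [a] and [b]. *)
Lemma jexp_swap a b s r t : (t <= s + r)%N ->
  jexp a b s t = jexp b a r (s + r - t).
Proof.
move=> le_t; rewrite /jexp.
have -> : (s + r - t - r = s - t)%N by lia.
have -> : (r - (s + r - t) = t - s)%N by lia.
lia.
Qed.

(** From [d] to [d + 1] the exponent grows by [(a + b) d + a]; adding [(a + b)(r - d)] removes the
    dependence on [d]. *)
Lemma jexp_step a b s r t : (t <= r + s)%N ->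
  (jexp a b s t.+1 + (a + b) * (r + s - t) = jexp a b s t + (a + b) * r + a)%N.
Proof.
move=> le_t; have [le_st|lt_ts] := leqP s t.
  rewrite -(subnKC le_st) -addnS !jexpD binS bin1.
  have [p ->] : exists p, r = (t - s + p)%N by exists (r + s - t)%N; lia.
  by rewrite (_ : _ + _ - _ = p)%N; [nia | lia].
have [p ->] : exists p, s = (t + p.+1)%N by exists (s - t.+1)%N; lia.
rewrite /jexp.
have -> : (t.+1 - (t + p.+1) = 0)%N by lia.
have -> : (t - (t + p.+1) = 0)%N by lia.
have -> : (t + p.+1 - t.+1 = p)%N by lia.
have -> : (t + p.+1 - t = p.+1)%N by lia.
have -> : (r + (t + p.+1) - t = r + p.+1)%N by lia.
rewrite !binS !bin1 !bin0 /=; nia.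
Qed.

(** Since the exponent is at least [|d|], the terms with [|d| >= N] vanish. *)
Lemma jexp_ge a b s t : (0 < a)%N -> (0 < b)%N -> (t - s + (s - t) <= jexp a b s t)%N.
Proof.
move=> a0 b0; rewrite /jexp !binS !bin1; nia.
Qed.

(** * Gaussian binomial coefficients *)

Section QBinomial.
Variables (A : comNzRingType) (q : A) (N : nat).
Hypothesis qN : q ^+ N = 0.

Lemma tpochV_large n : (N <= n)%N -> tpochV q N n = tpochV q N N.
Proof.
move=> /(tpoch_large qN) eqn; rewrite -[LHS]mul1r -(tpochK qN N) mulrAC -eqn.
by rewrite tpochK // mul1r.
Qed.

(** The Gaussian binomial coefficient, with division by q-factorials done through their inverses in
    the truncated ring. *)
Definition tbin L t : A :=
  if (t <= L)%N then tpoch q L * (tpochV q N t * tpochV q N (L - t)) else 0.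

Lemma tbin0 L : tbin L 0 = 1.
Proof. by rewrite /tbin leq0n tpochV0 mul1r subn0 tpochK. Qed.

(** The q-Pascal rule, from [1 - q^(L+1) = (1 - q^(L-t)) + q^(L-t) (1 - q^(t+1))]. *)
Lemma tbinS L t : (t <= L)%N ->
  tbin L.+1 t.+1 = tbin L t.+1 + q ^+ (L - t) * tbin L t.
Proof.
move=> le_tL; rewrite /tbin ltnS le_tL subSS.
have [lt_tL|le_Lt] := ltnP t L; last first.
  have -> : t = L by lia.
  by rewrite subnn tpochV0 !mulr1 !tpochK // expr0 add0r mul1r.
rewrite tpochS -(tpochVS qN t) (_ : L - t = (L - t.+1).+1)%N; last by lia.
rewrite -(tpochVS qN (L - t.+1)) (_ : L.+1 = (L - t.+1).+1 + t.+1)%N; last by lia.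
rewrite exprD; ring.
Qed.

Lemma tbin_sym L t : (t <= L)%N -> tbin L (L - t) = tbin L t.
Proof.
by move=> le_t; rewrite /tbin le_t leq_subr subKn // [X in _ * X]mulrC.
Qed.

End QBinomial.

(** * The Jacobi triple product *)

Section JacobiTriple.
Variables (A : comNzRingType) (q : A) (N : nat).
Hypothesis qN : q ^+ N = 0.

(** The sum side of the finite triple product in base [q^(a+b)]; the summation variable is
    [d = t - s], from [-s] to [r]. *)
Definition jsum a b r s : A := \sum_(t < (r + s).+1)
  (-1) ^+ (t + s) * q ^+ jexp a b s t * tbin (q ^+ (a + b)) N (r + s) t.

Lemma expqMN M : (0 < M)%N -> (q ^+ M) ^+ N = 0.
Proof. by move=> M_gt0; rewrite -exprM mulnC exprM qN expr0n; case: M M_gt0. Qed.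

Lemma jsum_swap a b r s : jsum a b r s = jsum b a s r.
Proof.
rewrite /jsum (addnC s r) (addnC b a) (reindex_inj rev_ord_inj) /=.
apply: eq_bigr => t _; have le_t : (t <= r + s)%N by rewrite -ltnS.
rewrite subSS tbin_sym // (@jexp_swap a b s r) ?(addnC s r) ?leq_subr // subKn //.
congr (_ * _ * _); rewrite -signr_odd -[in RHS]signr_odd !oddD oddB // !oddD.
by case: (odd r); case: (odd s); case: (odd t).
Qed.

(** The q-Pascal rule splits the sum in two: one part is the old sum, and by [jexp_step] the other
    is a constant multiple of it. *)
Lemma jsumS a b r s : (0 < a + b)%N ->
  jsum a b r.+1 s = (1 - q ^+ (a + (a + b) * r)) * jsum a b r s.
Proof.
move=> /expqMN QN; rewrite /jsum addSn big_ord_recl /= tbin0 //.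
under eq_bigr => t _ do rewrite tbinS ?mulrDr // -1?ltnS //.
rewrite big_split /= addrA mulrBl mul1r; congr (_ + _).
  rewrite [in RHS]big_ord_recl tbin0 // /=.
  by rewrite big_ord_recr /= {2}/tbin ltnn mulr0 addr0.
rewrite mulr_sumr -sumrN; apply: eq_bigr => t _.
have le_t : (t <= r + s)%N by rewrite -ltnS.
rewrite /bump /= -exprM [LHS]mulrA.
have -> : (-1) ^+ (1 + t + s) * q ^+ jexp a b s (1 + t) * q ^+ ((a + b) * (r + s - t))
   = - ((-1) ^+ (t + s) * (q ^+ (jexp a b s t.+1 + (a + b) * (r + s - t)))) :> A.
  by rewrite -addnA !add1n exprS (exprD q); ring.
rewrite jexp_step // -addnA [(_ * r + a)%N]addnC (exprD q (jexp _ _ _ _)); ring.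
Qed.

(** A shifted q-binomial theorem: [jsumS] adds the factors in [a] one by one, and [jsum_swap]
    carries it over to the factors in [b]. *)
Lemma jsumE a b r s : (0 < a + b)%N -> jsum a b r s =
  \prod_(j < r) (1 - q ^+ (a + (a + b) * j)) * \prod_(j < s) (1 - q ^+ (b + (a + b) * j)).
Proof.
move=> ab_gt0; elim: r => [|r IH]; last first.
  by rewrite jsumS // IH big_ord_recr /=; ring.
rewrite big_ord0 mul1r; elim: s => [|s IH].
  rewrite !big_ord0 /jsum big_ord1 tbin0 ?expqMN // mulr1.
  by rewrite (jexpD a b 0 0) !muln0 !expr0 mulr1.
rewrite jsum_swap jsumS; last by rewrite addnC.
by rewrite jsum_swap IH big_ord_recr /= mulrC (addnC b a).
Qed.

(** The bilateral sum is folded by pairing the terms [d = n] and [d = -n - 1], which have opposite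
    signs and exponents differing by [(2n + 1) b]. *)
Lemma jacobi_triple a b : (0 < a)%N -> (0 < b)%N ->
  \sum_(n < N) (-1) ^+ n * q ^+ ((a + b) * 'C(n, 2) + a * n) * (1 - q ^+ (n.*2.+1 * b)) =
  \prod_(j < N.*2) ((1 - q ^+ (a + (a + b) * j)) * (1 - q ^+ (b + (a + b) * j)) *
                    (1 - q ^+ ((a + b) * j.+1))).
Proof.
move=> a_gt0 b_gt0; have ab_gt0 : (0 < a + b)%N by rewrite addn_gt0 a_gt0.
set Q := q ^+ (a + b); have QN : Q ^+ N = 0 by apply: expqMN.
rewrite !big_split /= -jsumE //.
have -> : \prod_(j < N.*2) (1 - q ^+ ((a + b) * j.+1)) = tpoch Q N.
  rewrite -(@tpoch_large _ Q N QN N.*2) -?addnn ?leq_addr // /tpoch big_add1 /= big_mkord.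
  by apply: eq_bigr => j _; rewrite exprM.
pose F t := (-1) ^+ t * q ^+ jexp a b N.*2 t.
(* With [r = s = 2N], only terms with [|t - 2N| < N] survive. Then [t] and [4N - t] are at least
   [N], all q-factorials have reached their limit, and the Gaussian binomial times [(Q)_N] is 1. *)
have -> : jsum a b N.*2 N.*2 * tpoch Q N = \sum_(t < N.*2 + N.*2.+1) F t.
  rewrite mulr_suml addnS; apply: eq_bigr => t _.
  have le_t : (t <= N.*2 + N.*2)%N by rewrite -ltnS.
  rewrite /F exprD -[(-1) ^+ N.*2]signr_odd odd_double mulr1 -mulrA.
  have [le_N|] := leqP N (jexp a b N.*2 t); first by rewrite (expq0 qN le_N) !(mul0r, mulr0).
  move=> /(leq_ltn_trans (jexp_ge _ _ a_gt0 b_gt0)) lt_tN.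
  rewrite /tbin le_t (tpoch_large QN (n := N.*2 + N.*2)); last by lia.
  rewrite (tpochV_large QN (n := t)) ?(tpochV_large QN (n := _ - t)); try lia.
  have -> : forall z e x y : A, z * (e * (x * (y * y))) * x = z * e * (x * y * (x * y))
    by move=> z e x y; ring.
  by rewrite (tpochK QN) !mulr1.
rewrite big_split_ord /=.
have sum_trunc (f : nat -> A) n : (N <= n)%N -> (forall d, (N <= d)%N -> f d = 0) ->
    \sum_(d < n) f d = \sum_(d < N) f d.
  move=> /subnKC <- f0; rewrite big_split_ord /= [X in _ + X]big1 ?addr0 // => d _.
  by rewrite f0 ?leq_addr.
rewrite [X in _ + X](sum_trunc (fun d => F (N.*2 + d)%N)); first last.
- move=> d le_Nd; rewrite /F (expq0 qN) ?mulr0 // (leq_trans _ (jexp_ge _ _ _ _)) //; lia.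
- lia.
rewrite [X in X + _](reindex_inj rev_ord_inj) /=.
rewrite [X in X + _](sum_trunc (fun d => F (N.*2 - d.+1)%N)); first last.
- move=> d le_Nd; rewrite /F (expq0 qN) ?mulr0 // (leq_trans _ (jexp_ge _ _ _ _)) //; lia.
- lia.
rewrite -big_split /=; apply: eq_bigr => d _; rewrite /F jexpD.
have le_d : (d.+1 <= N.*2)%N by have := ltn_ord d; lia.
rewrite (@jexp_swap _ _ _ N.*2); last by lia.
rewrite (_ : _ + _ - _ = N.*2 + d.+1)%N ?jexpD; last by lia.
rewrite binS bin1 (_ : _ + b * d.+1 = (a + b) * 'C(d, 2) + a * d + d.*2.+1 * b)%N; last by lia.
have -> : (-1) ^+ (N.*2 - d.+1) = - (-1) ^+ d :> A.
  by rewrite -signr_odd oddB // odd_double /= signrN signr_odd.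
have -> : (-1) ^+ (N.*2 + d) = (-1) ^+ d :> A.
  by rewrite -signr_odd oddD odd_double signr_odd.
by rewrite (exprD q (_ + _)); ring.
Qed.

(** Here [k.+1] stands for the [k] of the identities, so that [k.*2.+3] is the modulus [2k + 1]. *)
Definition AG_bad k i x := (x %% k.*2.+3 \in [:: 0; i; k.*2.+3 - i])%N.

(** Each block of [2k + 3] consecutive integers contains exactly three bad ones. Their residues are
    distinct because [0 < i <= k + 1]. *)
Lemma prod_bad k i n : (0 < i <= k.+1)%N ->
  \prod_(j < n) ((1 - q ^+ (k.*2.+3 - i + k.*2.+3 * j)) * (1 - q ^+ (i + k.*2.+3 * j)) *
                    (1 - q ^+ (k.*2.+3 * j.+1))) =
  \prod_(1 <= x < (n * k.*2.+3).+1 | AG_bad k i x) (1 - q ^+ x).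
Proof.
move=> /andP[i_gt0 le_ik]; rewrite big_add1 [RHS]big_mkcond big_nat_mul big_mkord.
apply: eq_bigr => j _; rewrite -[(j * _)%N]add0n (mulSn j) big_addn addnK /=.
set M := k.*2.+3; have eM : M = k.*2.+3 by [].
pose I (c x : nat) : A := if x.+1 == c then 1 - q ^+ (c + j * M) else 1.
have prodI c : (0 < c <= M)%N -> \prod_(0 <= x < M) I c x = 1 - q ^+ (c + j * M).
  (* The index [x] represents the residue [x.+1], so residues run over [1..M] and the class of 0 is
     represented by [M]. *)
  move=> /andP[c_gt0 le_cM]; rewrite -big_mkcond (eq_bigl (fun x => x == c.-1)); last by move=> x /=; lia.
  by rewrite big_nat1_eq /=; case: ifP => //; lia.
have -> : \prod_(0 <= x < M) (if AG_bad k i (x + j * M).+1 then 1 - q ^+ (x + j * M).+1 else 1) =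
  \prod_(0 <= x < M) (I (M - i)%N x * I i x * I M x).
  rewrite big_nat [RHS]big_nat; apply: eq_bigr => x /= lt_xM.
  rewrite /AG_bad /I -addSn -[X in (X %% _)%N]addnC modnMDl !inE.
  have [eqM|neM] := eqVneq x.+1 M.
    rewrite eqM modnn !eqxx /=.
    have /negbTE -> : M != (M - i)%N by lia.
    have /negbTE -> : M != i by lia.
    by rewrite !mul1r.
  rewrite modn_small; last by lia.
  have [eqi|nei] := eqVneq x.+1 i.
    have /negbTE iMi : i != (M - i)%N by lia.
    have /negbTE i0 : i != 0%N by lia.
    by rewrite eqi i0 iMi /= mul1r mulr1.
  by rewrite !mulr1 /=; case: eqVneq => [->|_].
by rewrite !big_split /= !prodI; try lia; rewrite -mulSn !(mulnC M).
Qed.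
End JacobiTriple.

(** * Evaluation of the recursive sum as a product *)

Section AndrewsGordon.
Variables (A : comNzRingType) (q : A) (N : nat).
Hypothesis qN : q ^+ N = 0.

(** At [m = 0] the factor [(q)_n / (q)_n] disappears from the series, leaving the triple product
    with [a = 2k + 3 - i] and [b = i]. *)
Lemma AGR_prod k i : (0 < i <= k.+1)%N ->
  AGR q N k i 0 = \prod_(1 <= x < N | ~~ AG_bad k i x) tgeom q N x.
Proof.
move=> i_bd; have /andP[i_gt0 le_ik] := i_bd.
have eqJ : AGR q N k i 0 * tpoch q N =
    \prod_(1 <= x < (N.*2 * k.*2.+3).+1 | AG_bad k i x) (1 - q ^+ x).
  rewrite (AGR_AGJ qN) // -prod_bad //.
  have eM : (k.*2.+3 = k.*2.+3 - i + i)%N by lia.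
  rewrite [in RHS](eq_bigr (fun j : 'I_N.*2 => (1 - q ^+ (k.*2.+3 - i + (k.*2.+3 - i + i) * j)) *
    (1 - q ^+ (i + (k.*2.+3 - i + i) * j)) * (1 - q ^+ ((k.*2.+3 - i + i) * j.+1)))); last first.
    by move=> j _; rewrite -eM.
  rewrite -(jacobi_triple qN) //; last by lia.
  rewrite -eM; apply: eq_bigr => n _.
  by rewrite addn0 (tpochK qN) mulr1 muln0 mul0n add0n add0n.
rewrite -[LHS]mulr1 -[X in _ * X = _](tpochK qN N) mulrA eqJ.
(* Writing [1/(q)_N] as [1/(q)_L] makes the bad factors cancel over the same range; the good factors
   of index at least [N] are 1. *)
set L := (N.*2 * k.*2.+3)%N; have le_NL : (N <= L)%N by rewrite /L; lia.
rewrite -(tpochV_large qN le_NL) /tpochV [X in _ * X](bigID (AG_bad k i)) /= mulrA -big_split /=.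
rewrite [X in X * _]big_nat_cond [X in X * _]big1 ?mul1r; last first.
  by move=> x /andP[/andP[x_gt0 _] _]; rewrite (tgeomK qN).
rewrite (@big_cat_nat _ _ _ N) ?(trunc_gt0 qN) //= 1?leqW //.
rewrite [X in _ * X]big_nat_cond [X in _ * X]big1 ?mulr1 //.
move=> x /andP[/andP[le_Nx _] _]; apply: tgeom_large => //; exact: trunc_gt0 qN.
Qed.
End AndrewsGordon.

(** * The recursive sum as a sum over tuples *)

Definition ffun_rcons (T : Type) m (g : {ffun 'I_m -> T}) (x : T) : {ffun 'I_m.+1 -> T} :=
  [ffun l => oapp g x (insub (val l))].

Lemma ffun_rcons_widen T m (g : {ffun 'I_m -> T}) x l :
  ffun_rcons g x (widen_ord (leqnSn m) l) = g l.
Proof. by rewrite ffunE (_ : insub _ = Some l) //=; exact: valK. Qed.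

Lemma ffun_rcons_max T m (g : {ffun 'I_m -> T}) x : ffun_rcons g x ord_max = x.
Proof. by rewrite ffunE insubF //= ltnn. Qed.

Lemma sum_ffun_rcons (V : nmodType) (T : finType) m (F : {ffun 'I_m.+1 -> T} -> V) :
  \sum_f F f = \sum_x \sum_g F (ffun_rcons g x).
Proof.
rewrite pair_big /= (reindex (fun p => ffun_rcons p.2 p.1)) //=; apply: onW_bij.
exists (fun f : {ffun 'I_m.+1 -> T} => (f ord_max, [ffun l => f (widen_ord (leqnSn m) l)])).
  move=> [x g] /=; rewrite ffun_rcons_max; congr pair.
  by apply/ffunP => l; rewrite ffunE ffun_rcons_widen.
move=> f; apply/ffunP => l; case: (unliftP ord_max l) => [l'|] ->.
  have -> : lift ord_max l' = widen_ord (leqnSn m) l' by apply/val_inj/lift_max.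
  by rewrite ffun_rcons_widen ffunE.
by rewrite ffun_rcons_max.
Qed.

Lemma tailsum_rcons m (g : {ffun 'I_m -> nat}) x j :
  tailsum (ffun_rcons g x) j = (tailsum g j + (j <= m.+1) * x)%N.
Proof.
rewrite /tailsum big_mkcond big_ord_recr /= ffun_rcons_max [in RHS]big_mkcond /=.
congr (_ + _)%N; last by case: leqP; rewrite ?mul1n.
by apply: eq_bigr => l _; rewrite ffun_rcons_widen.
Qed.

Lemma tailsum_large m (g : {ffun 'I_m -> nat}) j : (m < j)%N -> tailsum g j = 0%N.
Proof.
move=> lt_mj; rewrite /tailsum big1 // => l le_jl.
by have := ltn_ord l; lia.
Qed.

(** A new last component [x] raises every [N_j] by [x]. The cross terms [2 x N_j] of the squares are
    absorbed by moving the parameter from [mu] to [mu + 2x], which is why the recursion carries a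
    parameter. *)
Lemma AG_exponent_rcons m i mu (g : {ffun 'I_m -> nat}) x :
  (mu * \sum_(1 <= j < m.+2) tailsum (ffun_rcons g x) j +
     @AG_exponent m.+2 i (ffun_rcons g x) =
   mu * m.+1 * x + m.+1 * x ^ 2 + (m.+2 - i) * x +
     ((mu + x.*2) * \sum_(1 <= j < m.+1) tailsum g j + @AG_exponent m.+1 i g))%N.
Proof.
have sumE (F : nat -> nat) : \sum_(1 <= j < m.+2) F (tailsum (ffun_rcons g x) j) =
    (\sum_(1 <= j < m.+1) F (tailsum g j + x) + F x)%N.
  rewrite big_nat_recr //= tailsum_rcons tailsum_large // leqnn mul1n add0n; congr (_ + _)%N.
  by rewrite big_nat [RHS]big_nat; apply: eq_bigr => j /andP[_ /ltnW lt_j]; rewrite tailsum_rcons lt_j mul1n.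
have sumI : (\sum_(i <= j < m.+2) tailsum (ffun_rcons g x) j =
    \sum_(i <= j < m.+1) tailsum g j + (m.+2 - i) * x)%N.
  rewrite (eq_big_nat _ _ (F2 := fun j => (tailsum g j + x)%N)); last first.
    by move=> j /andP[_]; rewrite ltnS tailsum_rcons => ->; rewrite mul1n.
  rewrite big_split /= sum_nat_const_nat; congr (_ + _)%N.
  have [le_i|lt_i] := leqP i m.+1; last by rewrite !big_geq //; lia.
  by rewrite big_nat_recr //= tailsum_large // addn0.
have sumL : (\sum_(1 <= j < m.+1) (tailsum g j + x) = \sum_(1 <= j < m.+1) tailsum g j + m * x)%N.
  by rewrite big_split /= sum_nat_const_nat subSS subn0.
have sumQ : (\sum_(1 <= j < m.+1) (tailsum g j + x) ^ 2 =
    \sum_(1 <= j < m.+1) tailsum g j ^ 2 + x.*2 * \sum_(1 <= j < m.+1) tailsum g j + m * x ^ 2)%N.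
  rewrite (eq_bigr (fun j => tailsum g j ^ 2 + x.*2 * tailsum g j + x ^ 2)%N); last by move=> j _; lia.
  by rewrite !big_split /= -big_distrr /= sum_nat_const_nat subSS subn0.
rewrite /AG_exponent sumI (sumE id) (sumE (fun t => t ^ 2)%N) /= sumL sumQ; lia.
Qed.

(** The parameter [q^mu] enters the multiple sum through its power [N_1 + ... + N_m]. *)
Lemma AGR_sum (A : comNzRingType) (q : A) N m i mu : (0 < i)%N ->
  AGR q N m i mu = \sum_(f : {ffun 'I_m -> 'I_N})
    q ^+ (mu * \sum_(1 <= j < m.+1) tailsum [ffun l => f l : nat] j +
          @AG_exponent m.+1 i [ffun l => f l : nat]) * \prod_l tpochV q N (f l).
Proof.
move=> i_gt0; elim: m mu => [|m IH] mu.
  rewrite /AGR i_gt0 (eq_bigr (fun=> 1)) => [|f _].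
    by rewrite sumr_const card_ffun !card_ord expn0.
  by rewrite big_ord0 mulr1 /AG_exponent !big_geq //= !muln0.
rewrite AGRS sum_ffun_rcons; apply: eq_bigr => x _; rewrite IH mulr_sumr.
apply: eq_bigr => g _.
have -> : [ffun l => ffun_rcons g x l : nat] = ffun_rcons [ffun l => g l : nat] (val x).
  by apply/ffunP => l; rewrite !ffunE; case: insub => //= l'; rewrite ffunE.
rewrite AG_exponent_rcons big_ord_recr /= ffun_rcons_max.
rewrite [X in _ = _ * (X * _)](eq_bigr (fun l => tpochV q N (g l))); last by move=> l _; rewrite ffun_rcons_widen.
rewrite [in RHS]exprD; ring.
Qed.

Lemma Andrews_Gordon (A : comNzRingType) (q : A) N k i : q ^+ N = 0 ->
  (0 < i <= k.+1)%N ->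
  \sum_(f : {ffun 'I_k -> 'I_N}) q ^+ @AG_exponent k.+1 i [ffun l => f l : nat] *
     \prod_l tpochV q N (f l) =
  \prod_(1 <= x < N | ~~ AG_bad k i x) tgeom q N x.
Proof.
move=> qN i_bd; rewrite -(AGR_prod qN) // AGR_sum; last by case/andP: i_bd.
by apply: eq_bigr => f _; rewrite mul0n.
Qed.

(** * Finiteness of the decompositions of a totally positive integer *)

(** The map sends [p(x)] to [p(w)]; it is well defined because every polynomial vanishing at [x]
    vanishes at [w]. The source is a ring [T] over [L], so that both a whole field and a subfield
    can serve. *)
Lemma evaluation_morphism (F : fieldType) (L : fieldExtType F) (T : nzRingType)
    (v : {rmorphism T -> L}) (C : fieldType) (iota : {rmorphism F -> C}) (x : L) (w : C) :
  (forall p, root (map_poly (in_alg L) p) x -> root (map_poly iota p) w) ->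
  (forall y, exists p, v y = (map_poly (in_alg L) p).[x]) ->
  exists f : {rmorphism T -> C}, forall y p,
    v y = (map_poly (in_alg L) p).[x] -> f y = (map_poly iota p).[w].
Proof.
move=> root_w gen; have [P vP] := choice gen.
pose f y := (map_poly iota (P y)).[w].
have fE y p : v y = (map_poly (in_alg L) p).[x] -> f y = (map_poly iota p).[w].
  move=> vy; apply/eqP; rewrite -subr_eq0 -hornerN -hornerD -rmorphB; apply: root_w.
  by rewrite /root rmorphB hornerD hornerN -vP -vy subrr.
have fB : zmod_morphism f.
  move=> y z; rewrite (fE _ (P y - P z)); first by rewrite rmorphB hornerD hornerN.
  by rewrite !rmorphB hornerD hornerN -!vP.
have fM : monoid_morphism f.
  split=> [|y z]; first by rewrite (fE _ 1) ?rmorph1 ?hornerC // !rmorph1 hornerC.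
  by rewrite (fE _ (P y * P z)) ?rmorphM ?hornerM //= -!vP.
pose fBi := GRing.isZmodMorphism.Build _ _ f fB.
pose fMi := GRing.isMonoidMorphism.Build _ _ f fM.
by exists (HB.pack f fBi fMi : {rmorphism T -> C}).
Qed.

Lemma polyOver1P (F : fieldType) (L : fieldExtType F) (p : {poly L}) :
  p \is a polyOver 1%VS -> exists q, p = map_poly (in_alg L) q.
Proof.
move=> p1; have /choice[c cE] : forall i, exists c, p`_i = c%:A.
  by move=> i; have /vlineP := polyOverP p1 i.
exists (\poly_(i < size p) c i); apply/polyP => i; rewrite coef_map coef_poly /=.
by case: ltnP => [_|le_i]; [exact: cE | rewrite nth_default // scale0r].
Qed.

(** By the primitive element theorem [L = F(x)]; [x] is sent to a root in [C] of the image of its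
    minimal polynomial. *)
Lemma extend_embedding (F : fieldType) (L : fieldExtType F) (C : closedFieldType)
    (iota : {rmorphism F -> C}) : [pchar L] =i pred0 ->
  exists f : {rmorphism L -> C}, forall a, f a%:A = iota a.
Proof.
move=> char0; have sep : separable 1 {:L}%AS.
  by apply/separableP => y _; apply: pcharf0_separable.
have := eq_adjoin_separable_generator sep (sub1v _).
set x := separable_generator _ _ => genL.
have [m mE] := polyOver1P (minPolyOver 1 x).
have [w wm] : exists w, root (map_poly iota m) w.
  apply/closed_rootP; rewrite size_map_poly -(size_map_poly (in_alg L)) -mE size_minPoly.
  by rewrite eqSS.
have rootw p : root (map_poly (in_alg L) p) x -> root (map_poly iota p) w.
  move=> /minPoly_dvdp -/(_ 1%AS) dvd; apply: (@root_dvdp _ (map_poly iota m)) => //.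
  rewrite dvdp_map -(dvdp_map (in_alg L)) -mE; apply: dvd.
  by apply/polyOverP => i; rewrite coef_map /= memvZ ?mem1v.
have gen (y : L) : exists p, idfun y = (map_poly (in_alg L) p).[x].
  have : y \in <<1; x>>%VS by rewrite -genL memvf.
  by move=> /Fadjoin_polyP[p /polyOver1P[q ->] ->]; exists q.
have [f fE] := evaluation_morphism rootw gen; exists f => a.
by rewrite (fE _ a%:P) ?map_polyC ?hornerC.
Qed.

(** First [Q(a)] is embedded with [a] sent to [w]; the embedding is then extended to [K], seen as an
    extension of [Q(a)]. *)
Lemma conjugate_embedding (K : fieldExtType rat) (f0 : {rmorphism K -> algC}) (a : K) (w : algC) :
  root (minCpoly (f0 a)) w -> exists f : {rmorphism K -> algC}, f a = w.
Proof.
have [p0 [p0E _] p0P] := minCpolyP (f0 a); rewrite p0E => root_w.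
have rat_alg (p : {poly rat}) : map_poly f0 (map_poly (in_alg K) p) = map_poly ratr p.
  by rewrite -map_poly_comp; apply: eq_map_poly => c; rewrite /= rmorphZ_num rmorph1 mulr1.
pose E := <<1; a>>%AS.
have [f1 f1E] : exists f : {rmorphism subvs_of E -> algC}, forall y p,
    vsval y = (map_poly (in_alg K) p).[a] -> f y = (map_poly ratr p).[w].
  apply: evaluation_morphism => [p pa|y].
    apply: root_dvdp root_w; rewrite dvdp_map -p0P -rat_alg /root.
    by rewrite horner_map (rootP pa) rmorph0.
  have /Fadjoin_polyP[p /polyOver1P[q ->] yE] := subvsP y; exists q; exact: yE.
have char0 : [pchar fieldOver E] =i pred0.
  by move=> p; rewrite -(pchar_num rat p) -(pchar_lalg K p).
have [f2 f2E] := extend_embedding f1 char0.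
(* [f2] lives on [fieldOver E], which has the same elements and operations as [K]; it is repackaged
   as an embedding of [K]. *)
pose f2a := GRing.isZmodMorphism.Build K algC f2 (rmorphB f2).
pose f2m := GRing.isMonoidMorphism.Build K algC f2 (rmorph1 f2, rmorphM f2).
exists (HB.pack (f2 : K -> algC) f2a f2m : {rmorphism K -> algC}) => /=.
have aE : a \in E by apply: memv_adjoin.
rewrite -[a in LHS](vsprojK aE).
transitivity (f1 (vsproj E a)).
  by rewrite -f2E fieldOver_scaleE mulr1.
rewrite (f1E _ 'X) ?map_polyX ?hornerX //; exact: vsprojK.
Qed.

Lemma embedding_exists (K : fieldExtType rat) : exists f : {rmorphism K -> algC}, True.
Proof.
have char0 : [pchar K] =i pred0 by move=> p; rewrite pchar_lalg pchar_num.
by have [f _] := extend_embedding (ratr : {rmorphism rat -> algC}) char0; exists f.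
Qed.

(** Multiplying by [X - w] multiplies a bound on the coefficients by at most [1 + B]. *)
Lemma coef_prod_XsubC_bound (s : seq algC) (B : algC) k :
  {in s, forall w, `|w| <= B} -> 0 <= B ->
  `|(\prod_(w <- s) ('X - w%:P))`_k| <= (1 + B) ^+ size s.
Proof.
move=> + B0; elim: s k => [|w s IH] k sB.
  by rewrite big_nil coef1; case: eqP; rewrite ?normr1 ?normr0.
have /IH{}IH : {in s, forall w, `|w| <= B} by move=> z zs; apply: sB; rewrite inE zs orbT.
rewrite big_cons mulrBl coefB coefXM mul_polyC coefZ /= exprS mulrDl mul1r.
apply: le_trans (ler_normB _ _) _; apply: lerD.
  by case: eqP => // _; rewrite normr0 exprn_ge0 // addr_ge0.
by rewrite normrM ler_pM // sB // inE eqxx.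
Qed.

Lemma bounded_Zpolys_roots (d B : nat) : exists s : seq algC,
  forall (p : {poly int}) z, p != 0 -> (size p <= d)%N ->
    (forall k, (absz (p`_k)%R <= B)%N) -> root (map_poly intr p) z -> z \in s.
Proof.
(* Coefficients between [-B] and [B] are stored shifted by [B], so the polynomials are indexed by a
   finite type. *)
pose P (g : {ffun 'I_d -> 'I_(B.*2.+1)}) : {poly int} :=
  \poly_(i < d) (if insub i is Some j then ((g j)%:Z - B%:Z) else 0).
pose rts (p : {poly algC}) := sval (closed_field_poly_normal p).
exists (flatten [seq rts (map_poly intr (P g)) | g <- enum {ffun 'I_d -> 'I_(B.*2.+1)}]).
move=> p z p0 sz pB pz.
pose g := [ffun j : 'I_d => inord (absz (p`_j + B%:Z)) : 'I_(B.*2.+1)].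
apply/flattenP; exists (rts (map_poly intr (P g))); first by apply: map_f; rewrite mem_enum.
have <- : p = P g.
  apply/polyP => i; rewrite coef_poly; case: ltnP => [lt_id|le_di]; last first.
    by rewrite nth_default // (leq_trans sz).
  have -> : insub i = Some (Ordinal lt_id) by rewrite insubT.
  have /andP[pB1 pB2] : - B%:Z <= p`_i <= B%:Z by rewrite -ler_norml -abszE lez_nat.
  have pB0 : 0 <= p`_i + B%:Z by rewrite -lerBlDr sub0r.
  rewrite ffunE /= inordK /=; first by rewrite gez0_abs // addrK.
  by rewrite ltnS -lez_nat gez0_abs // -addnn PoszD lerD2r.
move: pz; rewrite /rts; case: (closed_field_poly_normal _) => r /= {1}->.
rewrite rootZ ?root_prod_XsubC // lead_coef_eq0 map_poly_eq0_id0 // intr_eq0 lead_coef_eq0 //.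
Qed.

Lemma finite_tp_integer_le (K : fieldExtType rat) (c : K) :
  finite_set [set a : K | tp_integer a /\ totally_positive (c - a)]%classic.
Proof.
have [f0 _] := embedding_exists K.
have [p0 [p0E p0_monic] p0P] := minCpolyP (f0 c).
have [rc rcE] := closed_field_poly_normal (minCpoly (f0 c)).
(* All values [f c] are roots of the minimal polynomial of [f0 c], so one bound serves every
   embedding. *)
have [M MP] : exists M : nat, forall f : {rmorphism K -> algC}, `|f c| <= M%:R.
  exists (Num.bound (\sum_(z <- rc) `|z|)) => f.
  have fc : f c \in rc.
    have : root (minCpoly (f0 c)) (f c).
      have rat_map (g : {rmorphism K -> algC}) : map_poly ratr p0 = map_poly g (map_poly (in_alg K) p0).
        by rewrite -map_poly_comp; apply: eq_map_poly => x; rewrite /= rmorphZ_num rmorph1 mulr1.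
      have : root (map_poly (in_alg K) p0) c.
        by rewrite -(fmorph_root f0) -rat_map -p0E root_minCpoly.
      by rewrite p0E (rat_map f) fmorph_root.
    by rewrite rcE (monicP (minCpoly_monic _)) scale1r root_prod_XsubC.
  apply: ltW; apply: le_lt_trans (archi_boundP _); last by apply: sumr_ge0.
  by rewrite (big_rem _ fc) /= lerDl sumr_ge0.
pose d := (\dim {:K}).+1.
have [s sP] := bounded_Zpolys_roots d.+1 (M.+1 ^ d).
apply: (@sub_finite_set _ _ (f0 @^-1` [set` s])%classic); last first.
  apply: finite_preimage; first by move=> x y _ _ /fmorph_inj.
  exact: finite_seq.
move=> a [[[pz pz_monic pza] a_gt0] ca_gt0] /=.
have aint : f0 a \in Aint.
  apply: (@root_monic_Aint (map_poly intr pz)).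
  - have -> : map_poly intr pz = map_poly f0 (map_poly intr pz).
      by rewrite -map_poly_comp; apply: eq_map_poly => x; rewrite /= rmorph_int.
    by rewrite fmorph_root.
  - exact: monic_map.
  - by apply/polyOverP => i; rewrite coef_map /= rpred_int.
have /floorpP[p pE] : minCpoly (f0 a) \is a polyOver Num.int by exact: aint.
have [r rE] := closed_field_poly_normal (minCpoly (f0 a)).
rewrite (monicP (minCpoly_monic _)) scale1r in rE.
(* Every conjugate of [f0 a] is some [f a], and total positivity of [a] and [c - a] gives
   [0 < f a < f c]. *)
have rM : {in r, forall w, `|w| <= M%:R}.
  move=> w; rewrite -root_prod_XsubC -rE => /conjugate_embedding[f <-].
  have fa : 0 < f a by exact: a_gt0.
  have fac : f a < f c by rewrite -subr_gt0 -rmorphB; exact: ca_gt0.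
  rewrite gtr0_norm //; apply: le_trans (ltW fac) _; apply: le_trans (MP f).
  by rewrite gtr0_norm // (lt_trans fa).
(* The minimal polynomial of [f0 a] divides that of [a], whose degree is at most the dimension of
   [K]. *)
have szr : (size r < d)%N.
  have [m mE] := polyOver1P (minPolyOver 1 a).
  have [q [qE _] qP] := minCpolyP (f0 a).
  have qm : q %| m.
    rewrite -qP; have -> : map_poly ratr m = map_poly f0 (map_poly (in_alg K) m).
      by rewrite -map_poly_comp; apply: eq_map_poly => x; rewrite /= rmorphZ_num rmorph1 mulr1.
    by rewrite fmorph_root -mE root_minPoly.
  have m0 : m != 0 by rewrite -(map_poly_eq0 (in_alg K)) -mE monic_neq0 // monic_minPoly.
  have := dvdp_leq m0 qm.
  rewrite -(size_map_poly (ratr : {rmorphism rat -> algC})) -qE rE size_prod_XsubC.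
  move=> /leq_trans; apply; rewrite -(size_map_poly (in_alg K)) -mE size_minPoly.
  by rewrite ltnS adjoin_degreeE dimv1 divn1 dimvS // subvf.
have coefp k : (absz (p`_k)%R <= M.+1 ^ d)%N.
  rewrite -(ler_nat algC) natr_absz intr_norm -(coef_map intr p k) -pE rE natrX.
  apply: le_trans (coef_prod_XsubC_bound _ rM _) _; first exact: ler0n.
  by rewrite nat1r; apply: ler_weXn2l; [rewrite ler1n | exact: ltnW].
have p0' : p != 0.
  by apply: contraNneq (monic_neq0 (minCpoly_monic (f0 a))) => p0'; rewrite pE p0' rmorph0.
apply: (sP p) => //; last by rewrite -pE root_minCpoly.
by rewrite -(size_map_inj_poly (@intr_inj algC) (rmorph0 _)) -pE rE size_prod_XsubC ltnW.
Qed.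

Local Open Scope classical_set_scope.

(** * Arithmetic of the exponent monoid *)

Section Exponents.
Variable K : fieldExtType rat.
Implicit Types c d t u x y z : expo K.

Lemma expo_valE x : tp_integer (val x) \/ val x = 0.
Proof. exact/asboolP/(expo_valP x). Qed.

Lemma val_expo0 : val (0 : expo K) = 0.
Proof. exact: raddf0. Qed.

Lemma val_expoD x y : val (x + y) = val x + val y.
Proof. exact: raddfD. Qed.

Lemma val_expoMn x n : val (x *+ n) = val x *+ n.
Proof. exact: raddfMn. Qed.

(** Since [K] has at least one embedding, 0 is not totally positive. *)
Lemma OplusE d : @Oplus K d = (d != 0) :> Prop.
Proof.
have [f _] := embedding_exists K.
apply/propext; split=> [[_ d_gt0]|d_neq0].
  by apply: contraTneq (d_gt0 f) => ->; rewrite val_expo0 rmorph0 ltxx.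
case: (expo_valE d) => // d0; case/eqP: d_neq0; apply/val_inj.
by rewrite d0 val_expo0.
Qed.

Lemma expo_addI x y z : x + y = x + z -> y = z.
Proof. by move=> /(congr1 val); rewrite !val_expoD => /addrI/val_inj. Qed.

Lemma expo_eqMn x y n : (0 < n)%N -> x *+ n = y *+ n -> x = y.
Proof.
move=> n_gt0 /(congr1 val); rewrite !val_expoMn -!(mulr_natr (val _)).
have /mulIf : n%:R != 0 :> K; last by move=> /[apply] /val_inj.
have [f _] := embedding_exists K.
by rewrite -(fmorph_eq0 f) rmorph_nat pnatr_eq0 -lt0n.
Qed.

Lemma expo_gt0 x (f : {rmorphism K -> algC}) : x != 0 -> 0 < f (val x).
Proof. by rewrite -OplusE => -[_]; apply. Qed.

(** Any embedding takes nonnegative values on the monoid. *)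
Lemma expo_add_eq0 x y : (x + y == 0) = (x == 0) && (y == 0).
Proof.
have [f _] := embedding_exists K.
have ge0 z : 0 <= f (val z).
  by have [->|/(expo_gt0 f)/ltW//] := eqVneq z 0; rewrite val_expo0 rmorph0.
apply/eqP/andP => [xy0|[/eqP-> /eqP->]]; last by rewrite addr0.
have := congr1 (fun z => f (val z)) xy0; rewrite val_expo0 val_expoD rmorphD rmorph0.
move=> /eqP; rewrite paddr_eq0 // !fmorph_eq0 => /andP[/eqP x0 /eqP y0].
by split; apply/eqP/val_inj; rewrite ?x0 ?y0 val_expo0.
Qed.

Lemma expo_mulrn_eq0 d n : d != 0 -> (d *+ n == 0) = (n == 0)%N.
Proof.
move=> d0; case: n => [|n]; first by rewrite mulr0n !eqxx.
by rewrite mulrS expo_add_eq0 (negbTE d0).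
Qed.

Lemma expo_mulrnI d : d != 0 -> injective (GRing.natmul d).
Proof.
move=> d0 m n; without loss le_mn : m n / (m <= n)%N.
  by move=> IH; case/orP: (leq_total m n) => [/IH h /h|/IH h /esym/h /esym].
rewrite -(subnKC le_mn) mulrnDr -[LHS]addr0 => /expo_addI/esym/eqP.
by rewrite expo_mulrn_eq0 // => /eqP ->; rewrite addn0.
Qed.

Definition expo_le x c := exists y, x + y = c.

Lemma expo_le_trans y x z : expo_le x y -> expo_le y z -> expo_le x z.
Proof. by move=> [u <-] [v <-]; exists (u + v); rewrite addrA. Qed.

Lemma expo_leMn d n : (0 < n)%N -> expo_le d (d *+ n).
Proof. by case: n => // n _; exists (d *+ n); rewrite mulrS. Qed.

(** Apart from 0 and [c], a summand [x] is a totally positive integer with [c - x] totally positive.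
    This finiteness underlies all coefficientwise arguments below. *)
Lemma finite_expo_le c : finite_set [set x | expo_le x c].
Proof.
pose S := [set a : K | tp_integer a /\ totally_positive (val c - a)] `|` [set 0; val c].
apply: (@sub_finite_set _ _ (@expo_val K @^-1` S)) => [x [y xyc]|].
  have [x0|x_neq0] := eqVneq x 0; first by right; left; rewrite x0; exact: val_expo0.
  have [y0|y_neq0] := eqVneq y 0; first by right; right; rewrite -xyc y0 addr0.
  left; split; first by have := x_neq0; rewrite -OplusE.
  have -> : val c - expo_val x = val y.
    by rewrite -xyc val_expoD /= addrC addKr.
  by have := y_neq0; rewrite -OplusE => -[].
apply: finite_preimage; first by move=> x y _ _ /val_inj.
rewrite finite_setU; split; first exact: finite_tp_integer_le.
by rewrite finite_setU; split; exact: finite_set1.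
Qed.

Lemma finite_antidiag c : finite_set [set p : expo K * expo K | p.1 + p.2 = c].
Proof.
apply: (@sub_finite_set _ _ ([set x | expo_le x c] `*` [set y | expo_le y c])).
  by move=> [x y] /= xyc; split; [exists y | exists x; rewrite addrC].
by apply: finite_setX; apply: finite_expo_le.
Qed.

(** The largest [n] such that [d] is [n] times an exponent leaves a primitive quotient, since a
    further divisor would increase [n]. *)
Lemma primitive_decomp d : d != 0 ->
  exists n t, [/\ (0 < n)%N, primitive t & d = t *+ n].
Proof.
move=> d0.
pose S := [set n | (0 < n)%N /\ exists t, d = t *+ n].
have [B SB] : exists B, forall n, S n -> (n <= B)%N.
  (* [h t] recovers the multiplier of [t] in [d], unique because [t] is nonzero; finitely many [t]
     thus leave finitely many [n]. *)
  pose h t := xget 0%N [set n | d = t *+ n].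
  have : finite_set (h @` [set x | expo_le x d]) by apply/finite_image/finite_expo_le.
  move=> /finite_seqP[s sE]; exists (\max_(n <- s) n)%N => n [n_gt0 [t dE]].
  have ns : n \in s.
    suff : [set` s] n by [].
    rewrite -sE; exists t; first by rewrite /= dE; exact: expo_leMn.
    apply: xget_unique => // m /= dm; apply: (@expo_mulrnI t); last by rewrite -dE.
    by apply: contraNneq d0 => t0; rewrite dE t0 mul0rn.
  by rewrite (big_rem _ ns) leq_maxl.
have exS : exists n, `[< S n >] by exists 1%N; apply/asboolP; split=> //; exists d.
have leS n : `[< S n >] -> (n <= B)%N by move=> /asboolP/SB.
case: (ex_maxnP exS leS) => n /asboolP[n_gt0 [t dE]] n_max; exists n, t; split=> //.
have t0 : t != 0 by apply: contraNneq d0 => t0; rewrite dE t0 mul0rn.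
split=> [|m m_ge2 [b _ tE]]; first by rewrite OplusE.
have /asboolP/n_max : S (m * n)%N.
  by split; [rewrite muln_gt0 n_gt0; lia | exists b; rewrite dE tE mulrnA].
by rewrite leqNgt ltn_Pmull.
Qed.

(** Bezout gives [m a = n b + 1], whence [t = b (u m - t n)]. The cofactor is an algebraic integer,
    totally positive because [t] is, so primitivity of [t] forces [b = 1]. *)
Lemma primitive_mulrn_coprime t u a b : primitive t -> u != 0 -> (0 < a)%N -> (0 < b)%N ->
  coprime a b -> t *+ a = u *+ b -> b = 1%N.
Proof.
move=> [Ot prim_t] u0 a_gt0 b_gt0 cop tu.
case: (ltngtP b 1%N) => // [|b_ge2]; first by lia.
have [m n mn _] := egcdnP b a_gt0.
rewrite (eqP cop) in mn.
have tE : val t = (val u *+ m - val t *+ n) *+ b.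
  rewrite mulrnBl -!mulrnA (mulnC m) mulrnA -val_expoMn -tu val_expoMn -mulrnA mulnC mn.
  by rewrite mulrnDr addrC addKr.
have b0 : (b%:R : algC) != 0 by rewrite pnatr_eq0; lia.
have Ob : tp_integer (val u *+ m - val t *+ n).
  split.
    have integral_mulrn z k : integralOver (intr : int -> K) (val z *+ k).
      rewrite -mulr_natr; apply: integral_mul; last exact: integral_nat.
      by case: (expo_valE z) => [[]//|->]; exact: integral0.
    by apply: integral_sub; apply: integral_mulrn.
  move=> f; have t0 : t != 0 by rewrite -OplusE.
  have := expo_gt0 f t0; rewrite {1}tE raddfMn pmulrn_lgt0 //; lia.
have Hb : val u *+ m - val t *+ n \in @expo_pred K by apply/asboolP; left.
case: (prim_t b b_ge2); exists (Expo Hb) => //.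
by apply/val_inj; rewrite val_expoMn /= -tE.
Qed.

Lemma primitive_neq0 t : primitive t -> t != 0.
Proof. by move=> [+ _]; rewrite OplusE. Qed.

(** After division of both multipliers by their gcd, the coprime case applied in both directions
    makes each of them 1. *)
Lemma primitive_decomp_uniq t u m n : primitive t -> primitive u ->
  (0 < m)%N -> (0 < n)%N -> t *+ m = u *+ n -> m = n /\ t = u.
Proof.
move=> pt pu m_gt0 n_gt0 tu; have [t0 u0] := (primitive_neq0 pt, primitive_neq0 pu).
set g := gcdn m n; have g_gt0 : (0 < g)%N by rewrite gcdn_gt0 m_gt0.
have mE : m = (m %/ g * g)%N by rewrite divnK // dvdn_gcdl.
have nE : n = (n %/ g * g)%N by rewrite divnK // dvdn_gcdr.
have cop : coprime (m %/ g) (n %/ g).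
  by rewrite /coprime -(eqn_pmul2r g_gt0) mul1n muln_gcdl -mE -nE.
have a_gt0 : (0 < m %/ g)%N by rewrite divn_gt0 // dvdn_leq // dvdn_gcdl.
have b_gt0 : (0 < n %/ g)%N by rewrite divn_gt0 // dvdn_leq // dvdn_gcdr.
have tu' : t *+ (m %/ g) = u *+ (n %/ g).
  by apply: (expo_eqMn g_gt0); rewrite -!mulrnA -mE -nE.
have b1 := primitive_mulrn_coprime pt u0 a_gt0 b_gt0 cop tu'.
rewrite coprime_sym in cop.
have a1 := primitive_mulrn_coprime pu t0 b_gt0 a_gt0 cop (esym tu').
by split; [rewrite mE nE a1 b1 | move: tu'; rewrite a1 b1].
Qed.

Lemma scale_mulrn t n : primitive t -> (0 < n)%N -> scale (t *+ n) = n.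
Proof.
move=> pt n_gt0; apply: xget_unique => [|m [m_gt0 [u pu E]]]; first by split=> //; exists t.
by have [] := primitive_decomp_uniq pt pu n_gt0 m_gt0 E.
Qed.

End Exponents.

(** * Products of q-sums *)

Section QMul.
Variables (R : realType) (K : fieldExtType rat).
Implicit Types (f g h : qsums R K) (c x y : expo K).

Lemma expo_le_seq c : exists s : seq (expo K), uniq s /\ (forall x, (x \in s) = `[< expo_le x c >]).
Proof.
have /finite_seqP[s sE] := finite_expo_le c.
exists (undup s); split; first exact: undup_uniq.
move=> x; rewrite mem_undup; have := congr1 (fun A => A x) sE => /= ->.
by apply/idP/asboolP.
Qed.

Lemma expo_le_addl x y c : x + y = c -> expo_le x c.
Proof. by exists y. Qed.

Lemma expo_le_addr x y c : x + y = c -> expo_le y c.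
Proof. by exists x; rewrite addrC. Qed.

(** Turns the finite-support sum over a curve [x + y = c] into a double sum over a fixed list, where
    summations can be exchanged. *)
Lemma qmulE f g c (s : seq (expo K)) : uniq s -> (forall x, expo_le x c -> x \in s) ->
  qmul f g c = \sum_(x <- s) \sum_(y <- s) if x + y == c then f x * g y else 0.
Proof.
move=> s_uniq sP; transitivity (\sum_(p <- [seq (x, y) | x <- s, y <- s])
    if p.1 + p.2 == c then f p.1 * g p.2 else 0); last by rewrite big_allpairs.
rewrite -big_mkcond /=.
rewrite bigfs => [||p /eqP pc /allpairsPdep]; last first.
- case; exists p.1, p.2; split; last by case: p pc.
    by apply/sP/expo_le_addl/pc.
  by apply/sP/expo_le_addr/pc.
- by apply: allpairs_uniq => // -[x y] [u v] _ _ [-> ->].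
by rewrite /qmul; apply: eq_fsbigl; apply/seteqP; split=> p /=; rewrite unfold_in => /eqP.
Qed.

Lemma qmulC : commutative (@qmul R K).
Proof.
move=> f g; apply/funext => c; have [s [s_uniq sE]] := expo_le_seq c.
have sP x : expo_le x c -> x \in s by rewrite sE => /asboolP.
rewrite !(qmulE _ _ s_uniq sP) exchange_big /=.
by apply: eq_bigr => x _; apply: eq_bigr => y _; rewrite addrC mulrC.
Qed.

Lemma qmul1f : left_id (@qone R K) (@qmul R K).
Proof.
move=> f; apply/funext => c; rewrite /qmul -(fsbig_widen [set (0, c)]).
- by rewrite fsbig_set1 /= /qone /qmon eqxx mul1r.
- by move=> _ -> /=; rewrite add0r.
- move=> [x y] /= [xyc ne]; rewrite /qone /qmon; case: eqP => [x0|]; last by rewrite mul0r.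
  by case: ne; rewrite -xyc x0 add0r.
Qed.

(** [half] expands one bracketing into a triple sum over a fixed list; commutativity brings the
    other bracketing to the same form. *)
Lemma qmulA : associative (@qmul R K).
Proof.
suff half f g h c (s : seq (expo K)) : uniq s -> (forall x, (x \in s) = `[< expo_le x c >]) ->
    qmul f (qmul g h) c = \sum_(x <- s) \sum_(y <- s) \sum_(z <- s)
      if x + (y + z) == c then f x * (g y * h z) else 0.
  move=> f g h; apply/funext => c; have [s [s_uniq sE]] := expo_le_seq c.
  rewrite (qmulC (qmul f g)) !(half _ _ _ c s) // [RHS]exchange_big /=.
  apply: eq_bigr => x _; rewrite [RHS]exchange_big /=.
  apply: eq_bigr => y _; apply: eq_bigr => z _.
  by rewrite addrA (addrC z) mulrA (mulrC (h z)).
move=> s_uniq sE.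
have sP x : expo_le x c -> x \in s by rewrite sE => /asboolP.
rewrite (qmulE _ _ s_uniq sP); apply: eq_bigr => x _.
transitivity (\sum_(w <- s) \sum_(y <- s) \sum_(z <- s)
   if (x + w == c) && (y + z == w) then f x * (g y * h z) else 0).
  apply: eq_big_seq => w; rewrite sE => /asboolP wc.
  case: eqP => [xw|_]; last by rewrite big1 // => y _; rewrite big1.
  rewrite (@qmulE _ _ _ s) // => [|u uw]; last exact/sP/(expo_le_trans uw).
  rewrite mulr_sumr; apply: eq_bigr => y _; rewrite mulr_sumr; apply: eq_bigr => z _ /=.
  by case: eqP => //; rewrite mulr0.
rewrite exchange_big; apply: eq_bigr => y _ /=; rewrite exchange_big; apply: eq_bigr => z _ /=.
rewrite -big_mkcond /=; case: eqP => [xyz|ne].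
  rewrite (eq_bigl (fun w => w == y + z)) => [|w]; last first.
    by rewrite andbC eq_sym; case: eqP => //= ->; rewrite xyz eqxx.
  by rewrite -big_filter filter_pred1_uniq ?big_seq1 //; apply/sP/(expo_le_addr xyz).
by rewrite big1 // => w /andP[/eqP xw /eqP yz]; case: ne; rewrite yz.
Qed.

End QMul.

HB.instance Definition _ (R : realType) (K : fieldExtType rat) :=
  Monoid.isComLaw.Build (qsums R K) (@qone R K) (@qmul R K)
    (@qmulA R K) (@qmulC R K) (@qmul1f R K).

(** * Reduction of infinite products to finite ones *)

Section QProd.
Variables (R : realType) (K : fieldExtType rat) (J : choiceType).
Implicit Types (f : J -> qsums R K) (c x y : expo K) (D : set J) (S : {fset J * expo K}).

Definition qprod_dom D c : set {fset J * expo K} :=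
  [set S : {fset J * expo K} | [/\ forall p, p \in S -> D p.1 /\ Oplus p.2,
               {in S &, injective (fun p : J * expo K => p.1)}
             & \sum_(p <- S) p.2 = c]].

Definition qprod_term f S : R := \prod_(p <- S) f p.1 p.2.

Lemma qprodE D f c : qprod D f c = \sum_(S \in qprod_dom D c) qprod_term f S.
Proof. by []. Qed.

Lemma qprod_dom_le D c S p : qprod_dom D c S -> p \in S -> expo_le p.2 c.
Proof.
move=> [_ _ <-] pS; exists (\sum_(r <- (S `\ p)%fset) r.2).
by rewrite [RHS](big_fsetD1 p).
Qed.

Lemma finite_qprod_dom D c : finite_set D -> finite_set (qprod_dom D c).
Proof.
move=> finD; have fin := finite_setX finD (finite_expo_le c).
apply: (@sub_finite_set _ _ [set` fpowerset (fset_set (D `*` [set x | expo_le x c]))]).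
  move=> S SD /=; rewrite fpowersetE; apply/fsubsetP => p pS.
  rewrite in_fset_set //; apply/mem_set; split; last exact: (qprod_dom_le SD pS).
  by case: SD => /(_ p pS)[].
exact: finite_fset.
Qed.

Lemma qprod_nil f c : qprod set0 f c = qone R c.
Proof.
have dom0 x S : qprod_dom set0 x S -> S = fset0 /\ x = 0.
  move=> [S0 _ <-]; have -> : S = fset0; last by rewrite big_seq_fset0.
  by apply/eqP; rewrite -fsubset0; apply/fsubsetP => p /S0[].
rewrite qprodE /qone /qmon; case: eqP => [->|c0].
  rewrite -(fsbig_widen [set fset0]).
  - by rewrite fsbig_set1 /qprod_term big_seq_fset0.
  - by move=> _ -> ; split; [|move=> p|rewrite big_seq_fset0].
  - by move=> S /= [/dom0[-> _]] /(_ erefl).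
by rewrite fsbig1 // => S /dom0[_ /c0].
Qed.

(** A set counted on the left contains either one pair [(j, x)], with [x] nonzero, or none; the
    latter case matches the constant term [f j 0 = 1]. The map [h] below is the resulting
    bijection. *)
Lemma qprod_cons f j (s : seq J) : j \notin s -> f j 0 = 1 ->
  qprod [set` j :: s] f = qmul (f j) (qprod [set` s] f).
Proof.
move=> js fj0; apply/funext => c.
pose A : set (expo K * expo K) := [set p | p.1 + p.2 = c].
(* [Q] is a finite set containing every [S] that occurs; over [A] times [Q], cut down by [B], the
   iterated sum becomes a single one. *)
pose Q : set {fset J * expo K} := \bigcup_(p in A) qprod_dom [set` s] p.2.
have finA : finite_set A := finite_antidiag c.
have finQ : finite_set Q.
  by apply: bigcup_finite => // p _; apply: finite_qprod_dom; exact: finite_seq.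
pose B : set ((expo K * expo K) * {fset J * expo K}) :=
  [set u | qprod_dom [set` s] u.1.2 u.2].
transitivity (\sum_(u \in (A `*` Q) `&` B) f j u.1.1 * qprod_term f u.2); last first.
  rewrite fsbig_mkcondr -(pair_fsbig _ (fun p S => if (p, S) \in B then f j p.1 * qprod_term f S else 0)) //.
  apply: eq_fsbigr => p /set_mem pA.
  have domQ : Q `&` qprod_dom [set` s] p.2 = qprod_dom [set` s] p.2.
    by apply: setIidr => S Sp; exists p.
  by rewrite qprodE mulr_fsumr -domQ fsbig_mkcondr.
pose h (u : (expo K * expo K) * {fset J * expo K}) : {fset J * expo K} :=
  if u.1.1 == 0 then u.2 else ((j, u.1.1) |` u.2)%fset.
have notin_dom x y S : qprod_dom [set` s] x S -> (j, y) \notin S.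
  by move=> [SD _ _]; apply/negP => /SD[/= js']; rewrite (negbTE js) in js'.
rewrite qprodE (reindex_fsbig h ((A `*` Q) `&` B)).
  apply: eq_fsbigr => -[[x y] S] /set_mem[_ SB]; rewrite /h /=.
  case: eqP => [->|_]; first by rewrite fj0 mul1r.
  by rewrite /qprod_term big_fsetU1 // (notin_dom _ _ _ SB).
split.
- move=> [[x y] S] [[/= xyc _] SB]; have [SD Sinj Ssum] := SB; rewrite /= in Ssum; rewrite /h /=.
  case: eqP => [x0|/eqP x0].
    split=> //; last by rewrite Ssum -xyc x0 add0r.
    by move=> p /SD[ps Op]; split=> //=; rewrite inE ps orbT.
  split.
  + move=> p; rewrite !inE => /orP[/eqP ->|/SD[ps Op]]; first by rewrite /= OplusE inE eqxx.
    by split=> //=; rewrite inE ps orbT.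
  + move=> p r; rewrite !inE => /orP[/eqP->|pS] /orP[/eqP->|rS] //=.
    * by move=> E; case: (SD r rS) => /=; rewrite -E (negbTE js).
    * by move=> E; case: (SD p pS) => /=; rewrite E (negbTE js).
    * exact: Sinj.
  + by rewrite big_fsetU1 ?(notin_dom _ _ _ SB) //= Ssum.
- move=> [[x y] S] [[x' y'] S'] /set_mem[[/= xyc _] /= SB] /set_mem[[/= xyc' _] /= SB'].
  rewrite /B /= in SB SB'; rewrite /h /= => hE.
  have xx' : x = x'.
    move: hE; case: eqP => [->|_]; case: eqP => [->|_] //.
    * by move=> E; have := fset1U1 (j, x') S'; rewrite -E (negbTE (notin_dom _ _ _ SB)).
    * by move=> E; have := fset1U1 (j, x) S; rewrite E (negbTE (notin_dom _ _ _ SB')).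
    * move=> E; have := fset1U1 (j, x) S; rewrite E !inE (negbTE (notin_dom _ _ _ SB')) orbF.
      by move=> /eqP[].
  have yy' : y = y' by apply: (@expo_addI _ x); rewrite xyc xx' xyc'.
  rewrite -yy' -xx'; congr (_, _); move: hE; rewrite -xx'; case: eqP => // _ E.
  by rewrite -(fsetU1K (notin_dom _ x _ SB)) E fsetU1K // (notin_dom _ _ _ SB').
- move=> S SD; have [SD1 SD2 SD3] := SD.
  have [/hasP[[b a] pS /= /eqP bj]|/hasPn noj] := boolP (has (fun p => p.1 == j) S).
    rewrite {b}bj in pS; pose y := \sum_(p <- (S `\ (j, a))%fset) p.2.
    have [_ Oa] := SD1 _ pS.
    have SB : qprod_dom [set` s] y (S `\ (j, a))%fset.
      split=> // [p|p r]; rewrite !inE.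
        move=> /andP[pa pS']; have [pj Op] := SD1 p pS'; split=> //=.
        move: pj; rewrite /= inE => /predU1P[pj|//].
        by case/eqP: pa; apply: SD2.
      by move=> /andP[_ pS'] /andP[_ rS']; exact: SD2.
    have ya : a + y = c by rewrite -SD3 [RHS](big_fsetD1 (j, a)).
    exists ((a, y), (S `\ (j, a))%fset).
      by split=> //; split=> //; exists (a, y).
    by rewrite /h /=; move: Oa; rewrite /= OplusE => /negbTE ->; rewrite fsetD1K.
  exists ((0, c), S); last by rewrite /h /= eqxx.
  have SB : qprod_dom [set` s] c S.
    split=> // p pS; have [pj Op] := SD1 p pS; split=> //.
    by move: pj; rewrite /= inE (negbTE (noj p pS)).
  split=> //; split; first by rewrite /A /= add0r.
  by exists (0, c) => //; rewrite /A /= add0r.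
Qed.

Lemma qprod_seq f (s : seq J) : uniq s -> (forall j, j \in s -> f j 0 = 1) ->
  qprod [set` s] f = \big[@qmul R K/@qone R K]_(j <- s) f j.
Proof.
elim: s => [|j s IH] /=.
  move=> _ _; rewrite big_nil; apply/funext => c; rewrite -(qprod_nil f c).
  by congr (qprod _ _ _); apply/seteqP; split.
move=> /andP[js s_uniq] fs; rewrite big_cons qprod_cons ?fs ?inE ?eqxx // IH // => i si.
by rewrite fs // inE si orbT.
Qed.

Lemma eq_qprod D f f' c : (forall j x, D j -> f j x = f' j x) -> qprod D f c = qprod D f' c.
Proof.
move=> ff'; rewrite !qprodE; apply: eq_fsbigr => S /set_mem[SD _ _].
by apply: eq_big_seq => p /SD[Dp _]; apply: ff'.
Qed.

(** A set [S] using an index outside [s] has a pair whose exponent is a nonzero summand of [c], so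
    its term is 0. *)
Lemma qprod_finite D f c (s : seq J) : uniq s -> (forall j, j \in s -> D j) ->
  (forall j, D j -> f j 0 = 1) ->
  (forall j x, D j -> j \notin s -> expo_le x c -> x != 0 -> f j x = 0) ->
  qprod D f c = (\big[@qmul R K/@qone R K]_(j <- s) f j) c.
Proof.
move=> s_uniq sD f0 fs; rewrite -(qprod_seq (f := f)) //; last by move=> j /sD/f0.
rewrite !qprodE; apply/esym/fsbig_widen.
  by move=> S [SD Sinj Sc]; split=> // p /SD[/= /sD].
move=> S [[SD Sinj Sc] nS] /=; have {}SD' := SD.
have /hasP[p pS /= ps] : has (fun p => p.1 \notin s) S.
  apply/negPn/negP => /hasPn sS; apply: nS; split=> // p pS.
  by have [_ Op] := SD p pS; split=> //=; have := sS p pS; rewrite negbK.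
have [Dp Op] := SD p pS; rewrite OplusE in Op.
rewrite /qprod_term (big_rem p) //= fs ?mul0r //.
by apply: (@qprod_dom_le D c S).
Qed.
End QProd.

(** * q-sums supported on the multiples of an exponent *)

Lemma AG_residueE m i n : (0 < i <= m.+1)%N -> AG_residue m.+1 i n = ~~ AG_bad m i n :> Prop.
Proof.
move=> i_bd; have -> : AG_bad m i n = [|| n %% m.*2.+3 == 0, n %% m.*2.+3 == i | n %% m.*2.+3 == m.*2.+3 - i]%N.
  by rewrite /AG_bad !inE.
rewrite /AG_residue; have -> : (2 * m.+1 + 1 = m.*2.+3)%N by lia.
have -> : (n%:Z == - i%:Z %[mod m.*2.+3])%Z = (n %% m.*2.+3 == m.*2.+3 - i)%N.
  have -> : (- i%:Z = (m.*2.+3 - i)%N%:Z %[mod m.*2.+3])%Z.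
    by rewrite -subzn ?modzDl //; lia.
  by rewrite !modz_nat eqz_nat (@modn_small (_ - _)) //; lia.
rewrite mod0z !modz_nat !eqz_nat (@modn_small i); last by lia.
apply/propext; rewrite !negb_or; split=> [[-> -> ->//]|/and3P[-> -> ->]//].
Qed.

(** The truncated identity is applied in [R[X] / (X^N)]; reduction modulo [X^N] preserves the
    coefficients below [N]. *)
Lemma Andrews_Gordon_coef (R : fieldType) k i N n : (0 < i <= k.+1)%N -> (n < N)%N ->
  (\sum_(f : {ffun 'I_k -> 'I_N}) 'X^(@AG_exponent k.+1 i [ffun l => f l : nat]) *
     \prod_l tpochV ('X : {poly R}) N (f l))`_n =
  (\prod_(1 <= x < N | ~~ AG_bad k i x) tgeom ('X : {poly R}) N x)`_n.
Proof.
move=> i_bd lt_nN.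
have N_gt0 : (0 < N)%N by apply: leq_ltn_trans lt_nN.
pose pi : {rmorphism {poly R} -> {poly %/ ('X^N : {poly R})}} := in_qpoly 'X^N.
have valpi (p : {poly R}) : val (pi p) = take_poly N p.
  by rewrite /pi /= mk_monic_Xn prednK // Pdiv.RingMonic.take_poly_rmodp.
have piE (p : {poly R}) : (val (pi p))`_n = p`_n by rewrite valpi coef_take_poly lt_nN.
have piX : pi 'X ^+ N = 0.
  rewrite -rmorphXn; apply/val_inj; rewrite valpi; apply/polyP => j.
  by rewrite coef_take_poly coefXn coef0; case: ltngtP.
have pi_geom j : pi (tgeom 'X N j) = tgeom (pi 'X) N j.
  by rewrite /tgeom rmorph_sum; apply: eq_bigr => m _; rewrite rmorphXn.
rewrite -[LHS]piE -[RHS]piE; congr (_`_n).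
have pi_pochV j : pi (tpochV 'X N j) = tpochV (pi 'X) N j.
  by rewrite /tpochV rmorph_prod; apply: eq_bigr => x _; rewrite pi_geom.
rewrite rmorph_prod (eq_bigr (tgeom (pi 'X) N)) => [|x _]; last exact: pi_geom.
rewrite -(Andrews_Gordon piX i_bd) rmorph_sum; congr (val _).
have termE (f : {ffun 'I_k -> 'I_N}) :
    pi ('X^(@AG_exponent k.+1 i [ffun l => f l : nat]) * \prod_l tpochV 'X N (f l)) =
    pi 'X ^+ @AG_exponent k.+1 i [ffun l => f l : nat] * \prod_l tpochV (pi 'X) N (f l).
  rewrite rmorphM rmorphXn rmorph_prod; congr (_ * _).
  by apply: eq_bigr => l _; exact: pi_pochV.
by under eq_bigr => f _ do rewrite termE.
Qed.

Lemma qmulDl_sub (R : realType) (K : fieldExtType rat) (f g h : qsums R K) :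
  qmul (qsub f g) h = qsub (qmul f h) (qmul g h).
Proof.
apply/funext => c; have [s [s_uniq sE]] := expo_le_seq c.
have sP x : expo_le x c -> x \in s by rewrite sE => /asboolP.
rewrite {2}/qsub !(qmulE _ _ s_uniq sP) -sumrB; apply: eq_bigr => x _.
by rewrite -sumrB; apply: eq_bigr => y _; case: eqP; rewrite ?subr0 // mulrBl.
Qed.

(** * Power series in one monomial *)

Section Multiples.
Variables (R : realType) (K : fieldExtType rat) (t : expo K).
Hypothesis t0 : t != 0.
Implicit Types (u v : qsums R K) (p : {poly R}).

Definition multiple (x : expo K) := exists n, x = t *+ n.

Lemma expo_le_multiple m n : expo_le (t *+ m) (t *+ n) -> (m <= n)%N.
Proof.
move=> [y tmn]; rewrite leqNgt; apply/negP => lt_nm; move: tmn.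
rewrite -(subnKC (ltnW lt_nm)) mulrnDr -addrA -[RHS]addr0 => /expo_addI/eqP.
by rewrite expo_add_eq0 expo_mulrn_eq0 // subn_eq0 leqNgt lt_nm.
Qed.

(* [u] is a power series in [q^t] and agrees with [p] modulo the N-th power. *)
Definition series_mod N u p :=
  (forall x, u x != 0 -> multiple x) /\ forall n, (n < N)%N -> u (t *+ n) = p`_n.

(** If [x + y = t n] and [x] is a multiple of [t], cancellation makes [y] one too, so only the usual
    Cauchy product remains. *)
Lemma qmul_multiple u v n : (forall x, u x != 0 -> multiple x) ->
  qmul u v (t *+ n) = \sum_(j < n.+1) u (t *+ j) * v (t *+ (n - j)).
Proof.
move=> um; rewrite -(big_mkord xpredT (fun j => u (t *+ j) * v (t *+ (n - j)))).
pose r := [seq (t *+ j, t *+ (n - j)) | j <- index_iota 0 n.+1].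
rewrite /qmul (fsbigE r).
- rewrite big_map big_seq_cond [RHS]big_seq_cond; apply: eq_big => // j.
  rewrite mem_index_iota ltnS /= andbT; case le_jn : (j <= n)%N => //=; apply/mem_set => /=.
  by rewrite -mulrnDr subnKC.
- by rewrite map_inj_uniq ?iota_uniq // => i j [/(expo_mulrnI t0)].
- move=> p /= /mapP[j]; rewrite mem_index_iota ltnS => /andP[_ le_jn] -> /=.
  by rewrite -mulrnDr subnKC.
- move=> [x y] /= xy nr; have [->|ux] := eqVneq (u x) 0; first by rewrite mul0r.
  have [j xE] := um x ux; have le_jn : (j <= n)%N.
    by apply: expo_le_multiple; rewrite -xE; exists y.
  case/negP: nr; apply/mapP; exists j; first by rewrite mem_index_iota ltnS.
  rewrite xE; congr pair; apply: (@expo_addI _ x); rewrite xy xE -mulrnDr subnKC //.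
Qed.

Lemma series_modM N u v p p' : series_mod N u p -> series_mod N v p' ->
  series_mod N (qmul u v) (p * p').
Proof.
move=> [um up] [vm vp]; split=> [x|n lt_nN].
  (* A nonzero coefficient of the product comes from a nonzero term; [unit] fills a dummy
     parameter. *)
  move=> /(@fsbigN1 _ _ _ unit _ _ (fun _ r => u r.1 * v r.2) tt)[[y z] /= yz]; rewrite mulf_eq0 negb_or => /andP[/um[i yE] /vm[j zE]].
  by exists (i + j)%N; rewrite -yz yE zE mulrnDr.
rewrite qmul_multiple // coefM; apply: eq_bigr => j _.
have le_jn : (j <= n)%N by rewrite -ltnS.
by rewrite up ?vp // (leq_ltn_trans _ lt_nN) ?leq_subr.
Qed.

Lemma series_mod_mon N e : series_mod N (qmon R (t *+ e)) 'X^e.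
Proof.
split=> [x|n _]; first by rewrite /qmon; case: (x =P _) => [-> _|_]; [exists e | rewrite eqxx].
by rewrite /qmon coefXn (inj_eq (expo_mulrnI t0)).
Qed.

Lemma series_mod1 N : series_mod N (@qone R K) 1.
Proof. by have := series_mod_mon N 0; rewrite mulr0n expr0. Qed.

Lemma qgeomE m x : (0 < m)%N -> qgeom R (t *+ m) x = `[< exists n, x = t *+ (m * n) >]%:R.
Proof.
move=> m_gt0; rewrite /qgeom /qsum; case: asboolP => [[n ->]|ne]; last first.
  rewrite fsbig1 // => n _; rewrite /qmon; case: eqP => // xE.
  by case: ne; exists n; rewrite mulrnA.
rewrite -(fsbig_widen [set n]) //.
  by rewrite fsbig_set1 /qmon mulrnA eqxx.
move=> j [_ /= jn]; rewrite /qmon -mulrnA; case: eqP => // /(expo_mulrnI t0)/eqP.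
by rewrite eqn_pmul2l // => /eqP E; case: jn.
Qed.

Lemma series_mod_geom N m : (0 < m)%N -> series_mod N (qgeom R (t *+ m)) (tgeom 'X N m).
Proof.
move=> m_gt0; split=> [x|n lt_nN].
  by rewrite qgeomE //; case: asboolP => [[n ->] _|]; [exists (m * n)%N | rewrite eqxx].
rewrite qgeomE // /tgeom coef_sum; under eq_bigr => j _ do rewrite coefXn.
case: asboolP => [[j /(expo_mulrnI t0) nE]|ne]; last first.
  by rewrite big1 // => j _; case: eqP => // nE; case: ne; exists j; rewrite nE.
have lt_jN : (j < N)%N by apply: leq_ltn_trans lt_nN; rewrite nE leq_pmull.
rewrite (bigD1 (Ordinal lt_jN)) //= nE eqxx big1 ?addr0 // => i ij.
rewrite eqn_pmul2l //; case: eqP => // ji; case/eqP: ij; exact/val_inj.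
Qed.

Lemma series_mod_prod N (I : eqType) (s : seq I) (P : pred I) (F : I -> qsums R K) G :
  (forall i, i \in s -> P i -> series_mod N (F i) (G i)) ->
  series_mod N (\big[@qmul R K/@qone R K]_(i <- s | P i) F i) (\prod_(i <- s | P i) G i).
Proof.
move=> FG; rewrite big_seq_cond [X in series_mod _ _ X]big_seq_cond.
elim/big_ind2: _ => [|u p v p'|i /andP[]]; [exact: series_mod1|exact: series_modM|exact: FG].
Qed.

Lemma qgeomK m : (0 < m)%N -> qmul (qsub (@qone R K) (qmon R (t *+ m))) (qgeom R (t *+ m)) = @qone R K.
Proof.
move=> m_gt0; rewrite qmulDl_sub qmul1f; apply/funext => x; rewrite /qsub.
have [[n ->]|nx] := pselect (multiple x); last first.
  have [gm _] := series_mod_geom 0 m_gt0; have [g1 _] := series_mod1 0.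
  have [hm _] := series_modM (series_mod_mon 0 m) (series_mod_geom 0 m_gt0).
  have out u : (forall y, u y != 0 -> multiple y) -> u x = 0.
    by move=> um; apply/eqP/negPn/negP => /um.
  by rewrite !out // subr0.
have [_ gE] := series_mod_geom n.+1 m_gt0.
have [_ hE] := series_modM (series_mod_mon n.+1 m) (series_mod_geom n.+1 m_gt0).
have [_ oE] := series_mod1 n.+1.
rewrite gE // hE // oE // -coefB.
(* The error of the truncated geometric series has degree [m (n + 1)], above [n]. *)
have -> : tgeom 'X n.+1 m - 'X^m * tgeom 'X n.+1 m = 1 - ('X^m) ^+ n.+1 :> {poly R}.
  rewrite -[RHS]opprB subrX1 -[RHS]mulNr opprB mulrBl mul1r /tgeom.
  by under eq_bigr => j _ do rewrite exprM.
rewrite coefB -exprM coefXn; case: eqP => [nE|_]; last by rewrite subr0.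
by have := leq_pmull n.+1 m_gt0; rewrite -nE ltnn.
Qed.

End Multiples.

Lemma qinv_eq (R : realType) (K : fieldExtType rat) (f g : qsums R K) :
  qmul f g = @qone R K -> qinv f = g.
Proof.
move=> fg; apply: (@xget_unique _ _ [set h : qsums R K | qmul f h = @qone R K]) => // h fh.
by rewrite -(qmul1f h) -fg (qmulC f) -qmulA fh qmulC qmul1f.
Qed.

(** * The Andrews-Gordon identity for one exponent *)

Section Factor.
Variables (R : realType) (K : fieldExtType rat) (t : expo K).
Hypothesis t0 : t != 0.

Definition qpochV (n : nat) : qsums R K :=
  \big[@qmul R K/@qone R K]_(1 <= j < n.+1) qgeom R (t *+ j).

Lemma qpochK n : qmul (qpoch R t n) (qpochV n) = @qone R K.
Proof.
rewrite /qpoch /qpochV -big_split big_nat big1 // => j /andP[j_gt0 _].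
exact: qgeomK.
Qed.

Lemma series_mod_AG_term N k i (f : {ffun 'I_k -> nat}) :
  series_mod t N (qmul (qmon R (t *+ @AG_exponent k.+1 i f))
      (qinv (\big[@qmul R K/@qone R K]_(l < k) qpoch R t (f l))))
    ('X^(@AG_exponent k.+1 i f) * \prod_(l < k) tpochV 'X N (f l)).
Proof.
rewrite (@qinv_eq _ _ _ (\big[@qmul R K/@qone R K]_(l < k) qpochV (f l))); last first.
  by rewrite -big_split big1 // => l _; exact: qpochK.
apply: (series_modM t0); first exact: series_mod_mon.
apply: series_mod_prod => // l _ _; apply: series_mod_prod => // j.
by rewrite mem_index_iota => /andP[j_gt0 _] _; apply: series_mod_geom.
Qed.

(** Each [n_l] is at most [N_1], hence at most [N_1^2], which is one of the summands of the
    exponent. *)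
Lemma leq_AG_exponent k i (f : {ffun 'I_k -> nat}) l : (f l <= @AG_exponent k.+1 i f)%N.
Proof.
apply: leq_trans (leq_addr _ _); rewrite /= big_ltn ?ltnS; last exact: leq_ltn_trans (ltn_ord l).
apply: leq_trans (leq_addr _ _); apply: (@leq_trans (tailsum f 1)); last by rewrite -mulnn; case: tailsum => // n; rewrite leq_pmulr.
by rewrite /tailsum (bigD1 l) //= leq_addr.
Qed.

Lemma AG_sum_multiple k i N n : (n < N)%N ->
  AG_sum R k.+1 i t (t *+ n) =
  (\sum_(f : {ffun 'I_k -> 'I_N}) 'X^(@AG_exponent k.+1 i [ffun l => f l : nat]) *
     \prod_l tpochV ('X : {poly R}) N (f l))`_n.
Proof.
move=> lt_nN; rewrite /AG_sum /qsum.
pose h (f : {ffun 'I_k -> 'I_N}) : {ffun 'I_k -> nat} := [ffun l => f l : nat].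
have h_inj : injective h.
  by move=> f g /ffunP fg; apply/ffunP => l; apply/val_inj; have := fg l; rewrite !ffunE.
(* A tuple with a component at least [N] has exponent at least [N > n], hence no coefficient at
   [t *+ n]. *)
rewrite (fsbigE [seq h f | f <- enum {ffun 'I_k -> 'I_N}]) //=; last first.
- move=> f _ nf; have [_ ->//] := series_mod_AG_term N i f.
  rewrite coefXnM; case: ltnP => // le_en.
  case/negP: nf; apply/mapP.
  have f_lt l : (f l < N)%N.
    by apply: leq_ltn_trans lt_nN; apply: leq_trans le_en; exact: leq_AG_exponent.
  exists [ffun l => Ordinal (f_lt l)]; first by rewrite mem_enum.
  by apply/ffunP => l; rewrite !ffunE.
- by rewrite map_inj_uniq ?enum_uniq.
rewrite big_mkcond /= big_map big_enum /= coef_sum; apply: eq_bigr => f _.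
rewrite in_setT; have [_ ->//] := series_mod_AG_term N i (h f).
by rewrite (eq_bigr (fun l => tpochV 'X N (f l))) // => l _; rewrite ffunE.
Qed.

Lemma AG_sum_not_multiple k i x : ~ multiple t x -> AG_sum R k.+1 i t x = 0.
Proof.
move=> nx; rewrite /AG_sum /qsum fsbig1 // => f _.
have [fm _] := series_mod_AG_term 0 i f.
by apply/eqP/negPn/negP => /fm.
Qed.

Lemma qprod_geom_multiple (D : set nat) x :
  (forall n, D n -> (0 < n)%N) ->
  qprod D (fun n => qgeom R (t *+ n)) x != 0 -> multiple t x.
Proof.
move=> D0 /(@fsbigN1 _ _ _ unit _ _ (fun _ S => @qprod_term R K nat (fun n => qgeom R (t *+ n)) S) tt).
move=> [S [SD _ <-]] S0.
have : forall p, p \in S -> multiple t p.2.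
  move=> p pS; have [/D0 p_gt0 _] := SD p pS.
  have [gm _] := series_mod_geom R t0 0 p_gt0; apply: gm.
  by apply: contraNneq S0 => g0; rewrite /qprod_term (big_rem p) //= g0 mul0r.
move=> Sm; rewrite big_seq; elim/big_ind: _ => [|y z [i ->] [j ->]|p /Sm //].
  by exists 0%N; rewrite mulr0n.
by exists (i + j)%N; rewrite mulrnDr.
Qed.

Lemma qgeom0 (d : expo K) : d != 0 -> qgeom R d 0 = 1.
Proof.
move=> d0; rewrite -[d]mulr1n (qgeomE R d0) //; case: asboolP => // -[]; exists 0%N.
by rewrite muln0 mulr0n.
Qed.

(** Both sides are supported on multiples of [t], and their coefficients at [t *+ n] are those of
    [X^n] in the polynomial identity truncated at [n.+1]. *)
Lemma AG_sum_qprod k i : (0 < i <= k.+1)%N ->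
  AG_sum R k.+1 i t =
  qprod [set n : nat | (1 <= n)%N /\ AG_residue k.+1 i n] (fun n => qgeom R (t *+ n)).
Proof.
move=> i_bd; apply/funext => x.
have [[n ->]|nx] := pselect (multiple t x); last first.
  rewrite AG_sum_not_multiple //; apply/esym/eqP/negPn/negP => xm.
  by apply: nx; apply: qprod_geom_multiple xm => m [].
rewrite (@AG_sum_multiple k i n.+1) // Andrews_Gordon_coef //.
rewrite (@qprod_finite R K nat _ _ _ [seq m <- index_iota 1 n.+1 | ~~ AG_bad k i m]).
- rewrite big_filter; have [_ ->//] : series_mod t n.+1
    (\big[@qmul R K/@qone R K]_(1 <= m < n.+1 | ~~ AG_bad k i m) qgeom R (t *+ m))
    (\prod_(1 <= m < n.+1 | ~~ AG_bad k i m) tgeom 'X n.+1 m).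
  apply: series_mod_prod => // m; rewrite mem_index_iota => /andP[m_gt0 _] _.
  exact: series_mod_geom.
- by rewrite filter_uniq ?iota_uniq.
- move=> m; rewrite mem_filter mem_index_iota => /and3P[mb m_gt0 _].
  by split=> //; rewrite AG_residueE.
- by move=> m [m_gt0 _]; rewrite qgeom0 // expo_mulrn_eq0 // -lt0n.
move=> m x' [m_gt0 mb] ms x'n x'0; rewrite (qgeomE R t0) //; case: asboolP => // -[j x'E].
have j_gt0 : (0 < j)%N.
  by rewrite lt0n; apply: contraNneq x'0 => j0; rewrite x'E j0 muln0 mulr0n.
case/negP: ms; rewrite mem_filter mem_index_iota m_gt0 ltnS.
rewrite AG_residueE // in mb; rewrite mb /=.
have : (m * j <= n)%N by apply: (expo_le_multiple t0); rewrite -x'E.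
by apply: leq_trans; rewrite leq_pmulr.
Qed.

End Factor.

(** * Regrouping by primitive factors *)

Section Regroup.
Variables (R : realType) (K : fieldExtType rat).
Implicit Types (c d t x y : expo K).

Lemma qprod0 (J : choiceType) (D : set J) (f : J -> qsums R K) : qprod D f 0 = 1.
Proof.
have le0 x : expo_le x 0 -> x = 0.
  by move=> [y /eqP]; rewrite expo_add_eq0 => /andP[/eqP].
rewrite qprodE -(fsbig_widen [set fset0]).
- by rewrite fsbig_set1 /qprod_term big_seq_fset0.
- by move=> _ ->; split; [|move=> p|rewrite big_seq_fset0].
move=> S /= [SD nS]; case: nS; apply/eqP; rewrite -fsubset0; apply/fsubsetP => p pS.
have := le0 _ (qprod_dom_le SD pS); case: SD => /(_ p pS)[_]; rewrite OplusE => /eqP //.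
Qed.

(** The coefficient of a product at [c] only involves coefficients of the factors at summands of
    [c]. *)
Lemma eq_big_qmul (I : eqType) (s : seq I) (F G : I -> qsums R K) c :
  (forall i x, i \in s -> expo_le x c -> F i x = G i x) ->
  (\big[@qmul R K/@qone R K]_(i <- s) F i) c = (\big[@qmul R K/@qone R K]_(i <- s) G i) c.
Proof.
elim: s c => [|i s IH] c FG; first by rewrite !big_nil.
rewrite !big_cons /qmul; apply: eq_fsbigr => -[x y] /set_mem /= xyc.
congr (_ * _); first by apply: FG; [rewrite inE eqxx | exact: expo_le_addl xyc].
apply: IH => j z js zy; apply: FG; first by rewrite inE js orbT.
exact: (expo_le_trans zy (expo_le_addr xyc)).
Qed.

(* the factor t(d) *)
Definition primitive_part d : expo K :=
  xget 0 [set t | primitive t /\ d = t *+ scale d].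

Lemma scaleP d : d != 0 ->
  [/\ (0 < scale d)%N, primitive (primitive_part d) & d = primitive_part d *+ scale d].
Proof.
move=> /primitive_decomp[n [t [n_gt0 pt dE]]].
have sE : scale d = n by rewrite dE scale_mulrn.
have [pp dpp] : [set t | primitive t /\ d = t *+ scale d] (primitive_part d).
  by apply: (xgetI _ (x := t)); rewrite /= sE.
by split; rewrite // sE.
Qed.

Lemma primitive_part_mulrn t n : primitive t -> (0 < n)%N -> primitive_part (t *+ n) = t.
Proof.
move=> pt n_gt0; have tn0 : t *+ n != 0.
  by rewrite expo_mulrn_eq0 ?primitive_neq0 // -lt0n.
have [s_gt0 pp E] := scaleP tn0.
by have [] := primitive_decomp_uniq pt pp n_gt0 s_gt0 E.
Qed.

(** At a fixed [c] all products become finite: [s1] lists the primitive elements below [c], [s2] the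
    admissible exponents below [c], and [st t] the multipliers [n] for which [t *+ n] is in [s2]. *)
Lemma qprod_geom_regroup (A : set nat) : (forall n, A n -> (0 < n)%N) ->
  qprod (@primitive K) (fun t => qprod A (fun n => qgeom R (t *+ n))) =
  qprod [set d | Oplus d /\ A (scale d)] (@qgeom R K).
Proof.
move=> A0; apply/funext => c; have [s [s_uniq sE]] := expo_le_seq c.
have sP x : expo_le x c -> x \in s by rewrite sE => /asboolP.
have sle x : x \in s -> expo_le x c by rewrite sE => /asboolP.
pose s1 := [seq t <- s | `[< primitive t >]].
pose s2 := [seq d <- s | (d != 0) && `[< A (scale d) >]].
pose st t := [seq scale d | d <- s2 & primitive_part d == t].
have memst t n : primitive t -> (n \in st t) = `[< A n /\ expo_le (t *+ n) c >].
  move=> pt; apply/mapP/asboolP => [[d]|[An tnc]].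
    rewrite !mem_filter => /and3P[/eqP ppd /andP[d0 /asboolP Ad] ds] ->.
    split=> //; have [_ _] := scaleP d0; rewrite ppd => <-; exact: sle.
  have n_gt0 := A0 n An; exists (t *+ n); last by rewrite scale_mulrn.
  rewrite !mem_filter primitive_part_mulrn // eqxx scale_mulrn // sP // andbT.
  by rewrite expo_mulrn_eq0 ?primitive_neq0 // -lt0n n_gt0; apply/asboolP.
have geom_le t n x : primitive t -> A n -> x != 0 -> qgeom R (t *+ n) x != 0 -> expo_le (t *+ n) x.
  move=> pt An x0; rewrite (qgeomE R (primitive_neq0 pt)) ?A0 //.
  case: asboolP => [[j xE] _|]; last by rewrite eqxx.
  rewrite xE mulrnA; apply: expo_leMn; rewrite lt0n; apply: contraNneq x0 => j0.
  by rewrite xE j0 muln0 mulr0n.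
have geom0 t n : primitive t -> A n -> qgeom R (t *+ n) 0 = 1.
  move=> pt /A0 n_gt0; apply: qgeom0.
  by rewrite expo_mulrn_eq0 ?primitive_neq0 // -lt0n.
have geom_part d : d != 0 -> qgeom R d = qgeom R (primitive_part d *+ scale d).
  by move=> /scaleP[_ _ <-].
rewrite (@qprod_finite R K _ _ _ c s1); first last.
- move=> t x pt ts xc x0; apply/eqP/negPn/negP => /(qprod_geom_multiple (primitive_neq0 pt) A0)[n xE].
  case/negP: ts; rewrite mem_filter; apply/andP; split; first exact/asboolP.
  apply/sP/(expo_le_trans _ xc); rewrite xE; apply: expo_leMn; rewrite lt0n.
  by apply: contraNneq x0 => n0; rewrite xE n0 mulr0n.
- by move=> t _; exact: qprod0.
- by move=> t; rewrite mem_filter => /andP[/asboolP].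
- exact: filter_uniq.
rewrite (@eq_big_qmul _ _ _ (fun t => \big[@qmul R K/@qone R K]_(n <- st t) qgeom R (t *+ n))); last first.
  move=> t x; rewrite mem_filter => /andP[/asboolP pt _] xc.
  apply: qprod_finite.
  - rewrite map_inj_in_uniq; first by rewrite !filter_uniq.
    move=> d e; rewrite !mem_filter => /and3P[/eqP pd /andP[d0 _] _] /and3P[/eqP pe /andP[e0 _] _] de.
    by have [_ _ ->] := scaleP d0; have [_ _ ->] := scaleP e0; rewrite pd pe de.
  - by move=> n; rewrite memst // => /asboolP[].
  - by move=> n An; exact: geom0.
  - move=> n y An ns yx y0; apply/eqP/negPn/negP => /(geom_le _ _ _ pt An y0) tny.
    case/negP: ns; rewrite memst //; apply/asboolP; split=> //.
    exact/(expo_le_trans tny)/(expo_le_trans yx).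
rewrite (@qprod_finite R K _ _ _ c s2); first last.
- move=> d x [Od Ad] ds xc x0; rewrite OplusE in Od.
  have [sd pp dE] := scaleP Od.
  apply/eqP/negPn/negP; rewrite dE => /(geom_le _ _ _ pp Ad x0); rewrite -dE => dx.
  case/negP: ds; rewrite mem_filter Od sP ?andbT /=; last exact: expo_le_trans xc.
  exact/asboolP.
- by move=> d [Od _]; apply: qgeom0; rewrite -OplusE.
- by move=> d; rewrite mem_filter => /andP[/andP[d0 /asboolP Ad] _]; split; rewrite // OplusE.
- exact: filter_uniq.
congr (_ c).
transitivity (\big[@qmul R K/@qone R K]_(t <- s1) \big[@qmul R K/@qone R K]_(d <- s2 | primitive_part d == t) qgeom R d).
  apply: eq_big_seq => t _; rewrite /st big_map big_filter [LHS]big_seq_cond [RHS]big_seq_cond.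
  apply: eq_bigr => d; rewrite mem_filter => /andP[/andP[/andP[d0 _] _] /eqP <-].
  by rewrite -geom_part.
(* The primitive part of each [d] in [s2] occurs exactly once in [s1], so exchanging the products
   leaves one factor per [d]. *)
rewrite (exchange_big_dep xpredT) //=; apply: eq_big_seq => d.
rewrite mem_filter => /andP[/andP[d0 _] ds]; have [sd pp dE] := scaleP d0.
rewrite -big_filter (_ : [seq _ <- _ | _] = [:: primitive_part d]) ?big_seq1 //.
rewrite (eq_filter (a2 := pred1 (primitive_part d))); last by move=> t /=; rewrite eq_sym.
rewrite filter_pred1_uniq ?filter_uniq // mem_filter; apply/andP; split; first exact/asboolP.
apply/sP/(expo_le_trans _ (sle _ ds)); rewrite {2}dE; exact: expo_leMn.
Qed.
End Regroup.

Theorem theorem3p7 (R : realType) (K : fieldExtType rat)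
    (hK : totally_real K) (k i : nat) (hk : (2 <= k)%N) (hi : (1 <= i <= k)%N) :
  qprod (@primitive K) (fun g => AG_sum R k i g) =
  qprod (@primitive K) (fun g =>
    qprod [set n : nat | (1 <= n)%N /\ AG_residue k i n]
      (fun n => qgeom R (g *+ n)))
  /\
  qprod (@primitive K) (fun g =>
    qprod [set n : nat | (1 <= n)%N /\ AG_residue k i n]
      (fun n => qgeom R (g *+ n))) =
  qprod [set d : expo K | Oplus d /\ AG_residue k i (scale d)] (@qgeom R K).
Proof.
case: k hk hi => // k _ hi; split.
  apply/funext => c; apply: eq_qprod => t x pt.
  by rewrite AG_sum_qprod // primitive_neq0.
rewrite qprod_geom_regroup; last by move=> n [].
congr (qprod _ _); apply/seteqP; split=> d /= [Od].
  by move=> [].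
(* The condition [1 <= n] holds at [n = scale d] because [d] is nonzero. *)
by move=> Ad; split=> //; split=> //; have [] := @scaleP K d; rewrite -?OplusE.
Qed.
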